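(* There is a constant $c$ such that if LCS (over an arbitrary alphabet) on two sequences of length $N$ can be solved in time $S(N)$, then BP-SAT on $n$ variables for nondeterministic branching programs of length $T$ and width $W$ can be solved in $S(2^{n/2}\cdot T^{c\log W})$ time.
   Context: A nondeterministic branching program (BP) of length $T$ and width $W$ on Boolean inputs $x_1,\dots,x_n$ is a layered directed graph with layers $L_1,\dots,L_T$ of $W$ nodes each, nodes $(i,j)$, start node $(1,1)$ and accept node $(T,1)$. Every layer $i<T$ is labelled with a variable $x_{f(i)}$ and edges from $L_i$ to $L_{i+1}$ are labelled $0$ or $1$. The BP accepts $x\in\{0,1\}^n$ iff the accept node is reachable from the start node using only edges whose label equals the value under $x$ of the variable labelling the layer they leave. BP-SAT: decide whether some input is accepted. LCS: the length of a longest sequence that is a subsequence of both input sequences.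
   Formalization: In the exponent, log W is replaced by max(1, log W), which changes only W = 1, where the stated bound would not leave time to read the T layers; S is taken nondecreasing and time is counted up to a constant factor. *)

(* Defs.v *)
From HB Require Import structures.
From mathcomp Require Import all_boot all_order all_algebra.
From mathcomp Require Import boolp classical_sets reals topology normedtype exp.

Set Implicit Arguments.
Unset Strict Implicit.
Unset Printing Implicit Defensive.

Import Order.TTheory GRing.Theory Num.Theory.

(* -------------------------------------------------------------------------- *)
(* Word RAM.  Programs are structured (sequence, conditional, loop) rather    *)
(* than lists of instructions with jumps; the two forms simulate each other   *)
(* with constant-factor overhead, since a program is a fixed finite object.   *)
(* Registers and memory cells hold w-bit words, i.e. numbers below 2 ^ w, and *)
(* every executed instruction or test costs one unit of time.                 *)

Inductive binop :=
  OpAdd | OpSub | OpMul | OpDiv | OpMod | OpAnd | OpOr | OpXor | OpShl | OpShr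
| OpLt | OpEq.

(* Subtraction wraps around modulo 2 ^ w; x / 0 = 0 and x mod 0 = x.          *)
Definition eval_binop (w : nat) (o : binop) (x y : nat) : nat :=
  match o with
  | OpAdd => x + y
  | OpSub => x + (2 ^ w - y)
  | OpMul => x * y
  | OpDiv => x %/ y
  | OpMod => x %% y
  | OpAnd => Nat.land x y
  | OpOr => Nat.lor x y
  | OpXor => Nat.lxor x y
  | OpShl => x * 2 ^ y
  | OpShr => x %/ 2 ^ y
  | OpLt => x < y
  | OpEq => x == y
  end %% 2 ^ w.

(* Arguments of type nat are register names, except the constant of CConst.   *)
Inductive cmd :=
| CSkip
| CConst (r v : nat)               (* r := v          *)
| COp (o : binop) (r r1 r2 : nat)  (* r := r1 o r2    *)
| CLoad (r a : nat)                (* r := memory[a]  *)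
| CStore (a r : nat)               (* memory[a] := r  *)
| CSeq (c1 c2 : cmd)
| CIf (r : nat) (c1 c2 : cmd)      (* nonzero is true *)
| CWhile (r : nat) (c : cmd).

Record state := State { regs : nat -> nat; memory : nat -> nat }.

Definition update (f : nat -> nat) (i v : nat) : nat -> nat :=
  fun j => if j == i then v else f j.

Definition set_reg (s : state) (r v : nat) : state :=
  State (update (regs s) r v) (memory s).

Definition set_mem (s : state) (a v : nat) : state :=
  State (regs s) (update (memory s) a v).

(* [exec w c s t s']: with w-bit words, c started in s halts in s' after      *)
(* exactly t units of time.                                                   *)
Inductive exec (w : nat) : cmd -> state -> nat -> state -> Prop :=
| ExecSkip s : exec w CSkip s 0 s
| ExecConst s r v : exec w (CConst r v) s 1 (set_reg s r (v %% 2 ^ w))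
| ExecOp s o r r1 r2 :
    exec w (COp o r r1 r2) s 1
      (set_reg s r (eval_binop w o (regs s r1) (regs s r2)))
| ExecLoad s r a :
    exec w (CLoad r a) s 1 (set_reg s r (memory s (regs s a)))
| ExecStore s a r :
    exec w (CStore a r) s 1 (set_mem s (regs s a) (regs s r))
| ExecSeq c1 c2 s1 s2 s3 t1 t2 :
    exec w c1 s1 t1 s2 -> exec w c2 s2 t2 s3 ->
    exec w (CSeq c1 c2) s1 (t1 + t2) s3
| ExecIfTrue r c1 c2 s s' t :
    regs s r != 0 -> exec w c1 s t s' -> exec w (CIf r c1 c2) s t.+1 s'
| ExecIfFalse r c1 c2 s s' t :
    regs s r = 0 -> exec w c2 s t s' -> exec w (CIf r c1 c2) s t.+1 s'
| ExecWhileTrue r c s1 s2 s3 t1 t2 :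
    regs s1 r != 0 -> exec w c s1 t1 s2 -> exec w (CWhile r c) s2 t2 s3 ->
    exec w (CWhile r c) s1 (t1 + t2).+1 s3
| ExecWhileFalse r c s :
    regs s r = 0 -> exec w (CWhile r c) s 1 s.

(* The input occupies the first memory cells; everything else is zero.  The   *)
(* output is left in register 0.                                              *)
Definition init_state (input : seq nat) : state :=
  State (fun=> 0) (nth 0 input).

Definition output (s : state) : nat := regs s 0.

(* -------------------------------------------------------------------------- *)

Record problem := Problem {
  instance : Type;
  encoding : instance -> seq nat;
  answer : instance -> nat -> Prop }.

(* [solvable_in p t]: p can be solved in time O(t) on a word RAM.  Time is    *)
(* counted up to a constant factor, hence C, and the "+ 1" allows constant    *)
(* time where t < 1 (e.g. t = N log N at N = 1).  The word length is          *)
(* the usual one: any w such that the input entries are w-bit words and       *)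
(* w >= k log2 (input length + t + 2), with k a constant of the algorithm.    *)
(* Allowing t here is needed for running times exponential in the input       *)
(* length, since fewer bits could not address the memory in use.              *)
Definition solvable_in (R : realType) (p : problem) (t : instance p -> R) :
    Prop :=
  exists (c : cmd) (C k : nat), forall (x : instance p) (w : nat),
    all (fun v => v < 2 ^ w) (encoding x) ->
    (((size (encoding x))%:R + t x + 2) ^+ k <= (2 ^ w)%:R)%R ->
    exists (steps : nat) (s : state),
      [/\ exec w c (init_state (encoding x)) steps s,
          (steps%:R <= C%:R * (t x + 1))%R
        & answer x (output s)].

(* -------------------------------------------------------------------------- *)

Definition is_LCS_length (a b : seq nat) (l : nat) : Prop :=
  (exists s, [/\ subseq s a, subseq s b & size s = l]) /\
  (forall s, subseq s a -> subseq s b -> size s <= l).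

Record lcs_instance := LCSInstance {
  lcs_length : nat;
  lcs_fst : lcs_length.-tuple nat;
  lcs_snd : lcs_length.-tuple nat }.

(* The alphabet is the set of all words.                                      *)
Definition LCS : problem := {|
  instance := lcs_instance;
  encoding := fun I => lcs_length I :: lcs_fst I ++ lcs_snd I;
  answer := fun I => is_LCS_length (lcs_fst I) (lcs_snd I) |}.

(* -------------------------------------------------------------------------- *)

(* Layers and nodes are numbered from 0.  [bp_edge i j j' b]: there is an     *)
(* edge labelled b from node j of layer i to node j' of layer i.+1; a pair of *)
(* nodes may be joined by a 0-edge, a 1-edge, both or none.                   *)
Record bp := BP {
  bp_vars : nat;
  bp_length : nat;
  bp_width : nat;
  bp_length_gt0 : 0 < bp_length;
  bp_width_gt0 : 0 < bp_width;
  bp_label : 'I_bp_length.-1 -> 'I_bp_vars;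
  bp_edge : 'I_bp_length.-1 -> 'I_bp_width -> 'I_bp_width -> bool -> bool }.

Definition bp_node (B : bp) : finType := ('I_(bp_length B) * 'I_(bp_width B))%type.

Lemma bp_last_subproof (B : bp) : (bp_length B).-1 < bp_length B.
Proof. by rewrite ltn_predL bp_length_gt0. Qed.

Definition bp_start (B : bp) : bp_node B :=
  (Ordinal (bp_length_gt0 B), Ordinal (bp_width_gt0 B)).

Definition bp_accept (B : bp) : bp_node B :=
  (Ordinal (bp_last_subproof B), Ordinal (bp_width_gt0 B)).

Definition bp_step (B : bp) (x : {ffun 'I_(bp_vars B) -> bool}) :
    rel (bp_node B) :=
  fun u v => [exists i : 'I_(bp_length B).-1,
    [&& u.1 == i :> nat, v.1 == i.+1 :> nat
      & bp_edge i u.2 v.2 (x (bp_label i))]].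

Definition bp_accepts (B : bp) (x : {ffun 'I_(bp_vars B) -> bool}) : bool :=
  connect (bp_step x) (bp_start B) (bp_accept B).

Definition bp_satisfiable (B : bp) : bool := [exists x, bp_accepts (B := B) x].

Definition bp_encoding (B : bp) : seq nat :=
  [:: bp_vars B; bp_length B; bp_width B] ++
  [seq (bp_label i : nat) | i <- enum 'I_(bp_length B).-1] ++
  flatten [seq flatten [seq flatten [seq
      [:: nat_of_bool (bp_edge i j j' false); nat_of_bool (bp_edge i j j' true)]
    | j' <- enum 'I_(bp_width B)]
    | j <- enum 'I_(bp_width B)]
    | i <- enum 'I_(bp_length B).-1].

Definition BP_SAT : problem := {|
  instance := bp;
  encoding := bp_encoding;
  answer := fun B b => b = nat_of_bool (bp_satisfiable B) |}.

Definition log2 (R : realType) (W : nat) : R := (ln (W%:R : R) / ln 2)%R.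

(* Main.v *)
Require Import Defs.
From HB Require Import structures.
From mathcomp Require Import all_boot all_order all_algebra.
From mathcomp Require Import boolp classical_sets reals topology normedtype exp.
From mathcomp Require Import zify ring lra.

Set Implicit Arguments.
Unset Strict Implicit.
Unset Printing Implicit Defensive.

Import Order.TTheory GRing.Theory Num.Theory.

(** Every edge label reads a single variable, so each leaf depends on only one of the two half
    assignments. The other side always writes that leaf's own symbol, which makes a leaf common
    exactly when its edge is present under the combined assignment.

    A failing pair (a, b) can still match many leaves. Hence the LCS of a gadget pair only separates
    the value 2^k from the values up to K = 2^k - 1, and the separators must cost exactly K: a pair
    gains over the default 2PK only if it matches all 2^k leaves of some path.

    The recursion halves the walk instead of following it edge by edge, so its depth is ceil(log2 T)
    and (2W)^k stays within T^(O(log W)).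

    The function S is arbitrary apart from monotonicity. Time spent outside the LCS call is
    therefore charged to S through the linear lower bound for LCS, and the same bound controls the
    word length, because BP-SAT must provide words long enough for the larger LCS instance.

    The RAM has no recursion, so each symbol is computed separately from its position, by reading
    the position in base 2W. *)

(* Split the n variables into two halves of h = ceil(n/2) variables.  For
   assignments a of the first and b of the second half, unfold Savitch's
   recursion (some middle node is reachable in the first half of the layers and
   reaches the end in the second half) into a formula with (2W)^k leaves, where
   k = ceil(log2 T).  When every leaf has its own symbol, concatenating
   subformulas in the same order in both sequences adds LCS lengths, and
   concatenating them in opposite orders takes the maximum.  So sequences X_a
   and Y_b, each determined by one half of the assignment, have as LCS length the
   largest number of edges present on a path, which is 2^k iff (a, b) is
   accepting.

   The disjunction over all pairs (a, b) uses separators c and d.  With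
   K = 2^k - 1 and P = 2^h, let
     x = d^(PK) X_0 c^K d^K X_1 c^K d^K ... X_(P-1) c^K d^K d^(PK),
     y = c^(PK) Y_0 d^K c^K Y_1 d^K c^K ... Y_(P-1) d^K c^K c^(PK).
   Every matched pair (X_a, Y_b) loses K of the 2PK matches of separator c's of
   x and separator d's of y, so LCS(x, y) > 2PK iff LCS(X_a, Y_b) > K for some a
   and b.

   On the word RAM the two sequences are written above the input and then moved
   down to address 0, with all other cells cleared, as the LCS program expects.
   The time for this is O(S) because an LCS algorithm has to read its input. *)

(** * Common subsequences of concatenations *)

Lemma subseq_cat_split (s a b : seq nat) :
  subseq s (a ++ b) ->
  exists s1 s2, [/\ s = s1 ++ s2, subseq s1 a & subseq s2 b].
Proof.
elim: a s => [|x a IHa] s /=; first by exists [::], s.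
case: s => [|y s] /=; first by exists [::], [::]; rewrite ?sub0seq.
case: eqP => [<- /IHa [s1 [s2 [-> s1a s2b]]]|nyx /IHa [s1 [s2 [e s1a s2b]]]].
  by exists (y :: s1), s2; rewrite /= eqxx.
case: s1 e s1a => [|z s1] /= e s1a.
  by exists [::], s2.
by exists (z :: s1), s2; split=> //; case: e nyx s1a => <- _ /eqP/negPf ->.
Qed.

Lemma subseq_skip (s a b : seq nat) :
  subseq s (a ++ b) -> head 0 s \notin a -> subseq s b.
Proof.
move=> /subseq_cat_split [[|x s1] [s2 [-> s1a s2b]]] //= /negP [].
by apply: (mem_subseq s1a); rewrite inE eqxx.
Qed.

Definition common (s a b : seq nat) := subseq s a && subseq s b.

Definition disj (a b : seq nat) := forall y, y \in a -> y \in b -> False.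

Lemma common_disj s a b : disj a b -> common s a b -> s = [::].
Proof.
move=> dab /andP[sa sb]; case: s sa sb => // x s sa sb.
case: (dab x).
- by apply: (mem_subseq sa); rewrite inE eqxx.
- by apply: (mem_subseq sb); rewrite inE eqxx.
Qed.

Lemma cat_eq_cat (s1 s2 t1 t2 : seq nat) : s1 ++ s2 = t1 ++ t2 ->
  (exists r, t1 = s1 ++ r /\ s2 = r ++ t2) \/
  (exists r, s1 = t1 ++ r /\ t2 = r ++ s2).
Proof.
elim: s1 t1 => [|x s1 IH] [|y t1] /=.
- by move=> ->; left; exists [::].
- by move=> ->; left; exists (y :: t1).
- by move=> <-; right; exists (x :: s1).
- by case=> -> /IH [[r [-> ->]]|[r [-> ->]]]; [left|right]; exists r.
Qed.

(** The two sequences may cut [s] at different points. The piece between the cuts is common to [a2]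
    and [b1], or to [a1] and [b2], hence empty. *)
Lemma common_cat s a1 a2 b1 b2 : disj a1 b2 -> disj a2 b1 ->
  common s (a1 ++ a2) (b1 ++ b2) ->
  exists s1 s2, [/\ s = s1 ++ s2, common s1 a1 b1 & common s2 a2 b2].
Proof.
move=> d12 d21 /andP[/subseq_cat_split [s1 [s2 [es sa1 sa2]]]].
move=> /subseq_cat_split [t1 [t2 [et tb1 tb2]]].
have := et; rewrite es => /cat_eq_cat [] [r [e1 e2]].
- have r0 : r = [::].
    apply: (common_disj d21); rewrite /common.
    by rewrite (subseq_trans _ sa2) ?(subseq_trans _ tb1) ?e1 ?e2
         ?prefix_subseq ?suffix_subseq.
  exists s1, s2; split=> //; rewrite /common ?sa1 ?sa2 //=.
    by move: tb1; rewrite e1 r0 cats0.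
  by rewrite e2 r0.
- have r0 : r = [::].
    apply: (common_disj d12); rewrite /common.
    by rewrite (subseq_trans _ sa1) ?(subseq_trans _ tb2) ?e1 ?e2
         ?prefix_subseq ?suffix_subseq.
  exists s1, s2; split=> //; rewrite /common ?sa1 ?sa2 //=.
    by rewrite e1 r0 cats0.
  by move: tb2; rewrite e2 r0.
Qed.

Lemma common_cat_rev s a1 a2 b1 b2 : disj a1 b2 -> disj a2 b1 ->
  common s (a1 ++ a2) (b2 ++ b1) -> common s a1 b1 \/ common s a2 b2.
Proof.
move=> d12 d21 /andP[/subseq_cat_split [s1 [s2 [es sa1 sa2]]]].
move=> /subseq_cat_split [t2 [t1 [et tb2 tb1]]].
case: s1 es sa1 => [|x s1] /= es sa1.
  subst s2; right; suff t10 : t1 = [::].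
    by rewrite /common sa2 et t10 cats0 tb2.
  apply: (common_disj d21); rewrite /common tb1 andbT.
  by apply: subseq_trans sa2; rewrite et suffix_subseq.
case: t2 et tb2 => [|y t2] /= et tb2.
  subst t1; left; suff s20 : s2 = [::].
    by rewrite /common tb1 es s20 cats0 sa1.
  apply: (common_disj d21); rewrite /common sa2 /=.
  by apply: subseq_trans tb1; rewrite es -cat_cons suffix_subseq.
case: (d12 x).
- by apply: (mem_subseq sa1); rewrite inE eqxx.
- apply: (mem_subseq tb2); move: et; rewrite es => -[-> _].
  by rewrite inE eqxx.
Qed.

(** * The formula gadget *)

(** The second side lists the middle nodes in decreasing order. The opposite orders turn the sum of
    LCS lengths into a maximum. *)
Definition mid (W : nat) (z : bool) (m : nat) := if z then W.-1 - m else m.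

Section Gadget.
Variable W : nat.

(** The number [q] identifies the subformula by base 2W digits. A digit is built from the node [m]
    itself and not from its place in the list, so the two sides number a leaf alike although their
    orders differ. *)
Fixpoint leaves (leaf : nat -> nat -> nat -> nat -> nat) (z : bool)
    (k i u v q : nat) : seq nat :=
  if k is k'.+1 then
    flatten [seq leaves leaf z k' i.*2 u m (q * W.*2 + m.*2) ++
                 leaves leaf z k' i.*2.+1 m v (q * W.*2 + m.*2.+1)
            | m <- map (mid W z) (iota 0 W)]
  else [:: leaf i u v q].

(** Symbols 0 and 1 are kept for the separators. An absent edge gives 2 on one side and 3 on the
    other, so it never matches. *)
Definition leaf_symbol (present : nat -> nat -> nat -> bool) (z : bool)
    (i u v q : nat) : nat :=
  if present i u v then q + 4 else 2 + z.

Fixpoint reach (edge : nat -> nat -> nat -> bool) (k i u v : nat) : bool :=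
  if k is k'.+1 then
    has (fun m => reach edge k' i.*2 u m && reach edge k' i.*2.+1 m v)
        (iota 0 W)
  else edge i u v.

Lemma mid_rev z : map (mid W z) (iota 0 W) =
  if z then rev (iota 0 W) else iota 0 W.
Proof.
case: z; last by rewrite -[RHS]map_id.
apply: (@eq_from_nth _ 0) => [|i]; rewrite ?size_rev size_map ?size_iota // => iW.
by rewrite (nth_map 0) ?size_iota // nth_rev ?size_iota // !nth_iota /mid; lia.
Qed.

Lemma mem_mid z m : m \in map (mid W z) (iota 0 W) = (m < W).
Proof. by rewrite mid_rev; case: z; rewrite ?mem_rev mem_iota. Qed.

Lemma leaves_range f z k i u v q y :
  y \in leaves (leaf_symbol f z) z k i u v q ->
  y = 2 + z \/ q * W.*2 ^ k + 4 <= y < q.+1 * W.*2 ^ k + 4.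
Proof.
elim: k i u v q => [|k IHk] i u v q /=.
  rewrite inE => /eqP->; rewrite /leaf_symbol; case: (f i u v); [right|left]=> //.
  by rewrite expn0; lia.
move=> /flattenP [s /mapP [m]]; rewrite mem_mid => mW ->.
set X := W.*2 ^ k.
have aux q' : q' < W.*2 -> y = 2 + z \/
    (q * W.*2 + q') * X + 4 <= y < (q * W.*2 + q').+1 * X + 4 ->
    y = 2 + z \/ q * W.*2 ^ k.+1 + 4 <= y < q.+1 * W.*2 ^ k.+1 + 4.
  move=> q'W [->|yy]; [by left|right]; rewrite expnS -/X.
  have : q'.+1 * X <= W.*2 * X by rewrite leq_mul2r q'W orbT.
  nia.
by rewrite mem_cat => /orP[] /IHk; apply: aux; lia.
Qed.

Lemma size_leaves leaf z k i u v q : size (leaves leaf z k i u v q) = W.*2 ^ k.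
Proof.
elim: k i u v q => [|k IHk] i u v q //=.
rewrite size_flatten /shape -map_comp.
rewrite (@eq_map _ _ _ (fun=> (W.*2 ^ k).*2)); last first.
  by move=> m /=; rewrite size_cat !IHk addnn.
have aux (r : seq nat) c : sumn [seq c | _ <- r] = size r * c.
  by elim: r => //= x r ->.
by rewrite aux size_map size_iota expnS; lia.
Qed.

Variables fA fB : nat -> nat -> nat -> bool.
Let A := leaves (leaf_symbol fA false) false.
Let B := leaves (leaf_symbol fB true) true.
Let edge i u v := fA i u v && fB i u v.

Lemma leaves_disj k k' i u v q i' u' v' q' :
  (q'.+1 * W.*2 ^ k' <= q * W.*2 ^ k) || (q.+1 * W.*2 ^ k <= q' * W.*2 ^ k') ->
  disj (A k i u v q) (B k' i' u' v' q').
Proof.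
by move=> qq' y /leaves_range [|] r1 /leaves_range [|] r2; lia.
Qed.

(** Iterates [common_cat_rev]: in opposite orders a nonempty common word stays within a single
    index. *)
Lemma common_flatten_rev (F G : nat -> seq nat) (r : seq nat) s : uniq r ->
  (forall m m', m != m' -> disj (F m) (G m')) ->
  common s (flatten [seq F m | m <- r]) (flatten [seq G m | m <- rev r]) ->
  s = [::] \/ exists2 m, m \in r & common s (F m) (G m).
Proof.
elim: r => [|x r IHr] /=.
  by move=> _ _ /andP[]; rewrite subseq0 => /eqP ->; left.
case/andP=> xr ur d; rewrite rev_cons map_rcons flatten_rcons => c.
have mr t : t \in r -> t != x by move=> tr; apply: contraNneq xr => <-.
case: (common_cat_rev _ _ c).
- move=> y yF /flattenP [t /mapP [m]]; rewrite mem_rev => mr' -> yG.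
  by apply: (d x m) yF yG; rewrite eq_sym mr.
- by move=> y /flattenP [t /mapP [m mr' ->]] yF yG; apply: (d m x) yF yG; rewrite mr.
- by right; exists x => //; rewrite inE eqxx.
- case/(IHr ur d) => [|[m mr' mc]]; first by left.
  by right; exists m => //; rewrite inE mr' orbT.
Qed.

(** The opposite orders select one middle node and [common_cat] splits the word into its two halves.
    Each half has length at most 2^k, so the maximum 2^(k+1) forces both to be full. *)
Lemma leaves_upper k i u v q s : common s (A k i u v q) (B k i u v q) ->
  size s <= 2 ^ k /\ (size s = 2 ^ k -> reach edge k i u v).
Proof.
elim: k i u v q s => [|k IHk] i u v q s.
  change (common s [:: leaf_symbol fA false i u v q]
            [:: leaf_symbol fB true i u v q] -> size s <= 1 /\
            (size s = 1 -> edge i u v)); rewrite /common.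
  case: s => [|y [|y' s]]; first by split.
    rewrite !sub1seq !inE /leaf_symbol /edge /= => /andP[/eqP->].
    by case: (fA i u v); case: (fB i u v) => //=; lia.
  by case/andP=> /size_subseq.
have dj q1 q2 i1 u1 v1 i2 u2 v2 : q1 != q2 ->
   disj (A k i1 u1 v1 q1) (B k i2 u2 v2 q2).
  by move=> q12; apply: leaves_disj; rewrite !leq_mul2r; lia.
rewrite /A /B [X in common _ X _]/= [X in common _ _ X]/= !mid_rev => /common_flatten_rev.
case=> [|m m' mm'|->|[m mW]]; rewrite ?iota_uniq //.
- by move=> y; rewrite !mem_cat => /orP[] yA /orP[]; apply: dj yA; lia.
- by split=> //; move/esym/eqP; rewrite expn_eq0.
case/common_cat => [||s1 [s2 [-> c1 c2]]].
- by apply: dj; lia.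
- by apply: dj; lia.
have [le1 r1] := IHk _ _ _ _ _ c1; have [le2 r2] := IHk _ _ _ _ _ c2.
rewrite size_cat expnS; split; first by lia.
move=> e; apply/hasP; exists m => //=; apply/andP; split; [apply: r1 | apply: r2]; lia.
Qed.

Lemma subseq_flatten_map (F : nat -> seq nat) (r : seq nat) m s :
  m \in r -> subseq s (F m) -> subseq s (flatten [seq F m | m <- r]).
Proof.
elim: r => // x r IHr; rewrite inE => /orP[/eqP->|mr] sF /=.
  by rewrite -[s]cats0 cat_subseq ?sub0seq.
by rewrite -[s]cat0s cat_subseq ?sub0seq ?IHr.
Qed.

Lemma leaves_lower k i u v q : reach edge k i u v ->
  exists2 s, size s = 2 ^ k & common s (A k i u v q) (B k i u v q).
Proof.
elim: k i u v q => [|k IHk] i u v q /=.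
  case/andP=> a b; exists [:: q + 4] => //.
  by rewrite /common /A /B /= /leaf_symbol a b eqxx.
case/hasP=> m mW /andP[/IHk h1 /IHk h2].
have [s1 e1 /andP[sA1 sB1]] := h1 (q * W.*2 + m.*2).
have [s2 e2 /andP[sA2 sB2]] := h2 (q * W.*2 + m.*2.+1).
exists (s1 ++ s2); first by rewrite size_cat e1 e2 expnS; lia.
rewrite /common /A /B /=; apply/andP; split;
  by apply: (@subseq_flatten_map _ _ m); rewrite ?mem_mid ?cat_subseq //;
  move: mW; rewrite mem_iota.
Qed.
End Gadget.

(** * Selecting one pair of blocks *)

Section Selection.
Variable K : nat.

Definition sep (z : bool) : seq nat := nseq K (z : nat) ++ nseq K (~~ z : nat).

Definition blocks (z : bool) (Xs : seq (seq nat)) : seq nat :=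
  flatten [seq X ++ sep z | X <- Xs].

(** The margins [e] and [g] are free because the induction below discards blocks: the remaining half
    of a separator becomes the new left margin. *)
Definition select (z : bool) (e g : nat) (Xs : seq (seq nat)) : seq nat :=
  nseq e (~~ z : nat) ++ blocks z Xs ++ nseq g (~~ z : nat).

Lemma subseq_nseq_cat (s t : seq nat) b d : subseq s (nseq b d ++ t) ->
  exists b' s', [/\ s = nseq b' d ++ s', b' <= b & subseq s' t].
Proof.
case/subseq_cat_split=> s1 [s2 [-> s1d s2t]]; exists (size s1), s2; split=> //.
  congr (_ ++ _); apply/all_pred1P/allP => y /(mem_subseq s1d).
  by rewrite mem_nseq => /andP[].
by rewrite -[b in _ <= b](size_nseq b d) size_subseq.
Qed.

Definition plain (X : seq nat) := all (fun y => 1 < y) X.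

Lemma plain_bool X (b : bool) : plain X -> (b : nat) \notin X.
Proof. by move=> /allP pX; apply/negP => /pX; case: b. Qed.

Lemma blocks_cons z X Xs : blocks z (X :: Xs) =
  X ++ nseq K (z : nat) ++ nseq K (~~ z : nat) ++ blocks z Xs.
Proof. by rewrite /blocks /= /sep -!catA. Qed.

(* Induction on the number of blocks.  Every block is followed by K c's in x, or
   by K d's in y.  A word that starts with d skips the first block of y and uses
   its d's, and symmetrically for c.  After a match inside X and Y, the separators
   that follow them start with different symbols, so the word has to give up K
   symbols of one of them, which pays for the match. *)
Lemma select_upper n z Xs Ys e f g g' s : size Xs + size Ys <= n ->
  all plain Xs -> all plain Ys ->
  (forall X Y t, X \in Xs -> Y \in Ys -> common t X Y -> size t <= K) ->
  subseq s (select z e g Xs) -> subseq s (select (~~ z) f g' Ys) ->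
  size s <= (size Xs + size Ys) * K.
Proof.
have notb (b : bool) : (b : nat) != (~~ b : nat) by case: b.
elim: n z Xs Ys e f g g' s => [|n IHn] z Xs Ys e f g g' s.
  case: Xs => //; case: Ys => //= _ _ _ _ ; case: s => // y s.
  move=> /mem_subseq /(_ y); rewrite !mem_cat !mem_nseq inE eqxx => /(_ isT) h.
  move=> /mem_subseq /(_ y); rewrite !mem_cat !mem_nseq inE eqxx => /(_ isT).
  by move: h; case: z => /=; lia.
(* Quantified over [z], so that exchanging the two sides also covers words that start with the other
   separator symbol. *)
have D : forall z Xs Ys e f g g' s, size Xs + size Ys <= n.+1 ->
  all plain Xs -> all plain Ys ->
  (forall X Y t, X \in Xs -> Y \in Ys -> common t X Y -> size t <= K) ->
  subseq s (select z e g Xs) -> subseq s (select (~~ z) f g' Ys) ->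
  s != [::] -> head 0 s = (~~ z) ->
  size s <= (size Xs + size Ys) * K.
  move=> {}z {}Xs [|Y {}Ys] {}e {}f {}g {}g' {}s sz pX pY cXY sX sY s0 hs.
    case: s s0 hs sY {sX} => // y s _ /= -> /mem_subseq/(_ (~~ z : nat)).
    rewrite !mem_cat !mem_nseq inE eqxx => /(_ isT).
    by case: (z) => /=; lia.
  move: sY; rewrite /select negbK blocks_cons => /subseq_skip.
  rewrite hs mem_nseq eq_sym (negPf (notb z)) andbF => /(_ isT).
  rewrite -catA => /subseq_skip; rewrite hs plain_bool; last by case/andP: pY.
  move=> /(_ isT); rewrite -!catA => /subseq_nseq_cat [b [s' [es bK sY]]].
  have IH := IHn z Xs Ys e K g g' s'.
  have : size s' <= (size Xs + size Ys) * K.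
    apply: IH => //; first by clear -sz; move: sz => /=; lia.
    - by case/andP: pY.
    - by move=> X Y' t xX yY; apply: cXY; rewrite // inE yY orbT.
    - by apply: subseq_trans sX; rewrite es suffix_subseq.
    - by move: sY; rewrite /select !negbK.
  by rewrite es size_cat size_nseq /=; clear -bK; nia.
move=> sz pX pY cXY sX sY.
have [->|s0] := eqVneq s [::]; first by [].
have [hs|hz'] := eqVneq (head 0 s) (~~ z : nat); first exact: D sX sY _ _.
have [hs|hz] := eqVneq (head 0 s) (z : nat).
  rewrite addnC; apply: (D (~~ z) Ys Xs f e g' g) => //; rewrite ?negbK //.
    by rewrite addnC.
  by move=> X Y t xX yY; rewrite /common andbC; apply: cXY.
case: Xs sz pX cXY sX => [|X Xs] sz pX cXY sX.
  case: s s0 hz hz' sX {sY} => // y s _ /= _ hz' /mem_subseq/(_ y).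
  by rewrite !mem_cat !mem_nseq inE eqxx (negPf hz') !andbF => /(_ isT).
case: Ys sz pY cXY sY => [|Y Ys] sz pY cXY sY.
  case: s s0 hz hz' sY {sX} => // y s _ /= hz _ /mem_subseq/(_ y).
  by rewrite !mem_cat !mem_nseq inE eqxx negbK (negPf hz) !andbF => /(_ isT).
(* Here [s2] has already left [X] but may still be inside [Y]. *)
have E : forall (z : bool) X Xs Y Ys g g' s1 s2, size (X :: Xs) + size (Y :: Ys) <= n.+1 ->
  all plain (X :: Xs) -> all plain (Y :: Ys) ->
  (forall X' Y' t, X' \in X :: Xs -> Y' \in Y :: Ys ->
     common t X' Y' -> size t <= K) ->
  common s1 X Y ->
  subseq s2 (nseq K (z : nat) ++ nseq K (~~ z : nat) ++ blocks z Xs ++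
             nseq g (~~ z : nat)) ->
  subseq s2 (Y ++ nseq K (~~ z : nat) ++ nseq K (z : nat) ++ blocks (~~ z) Ys ++
             nseq g' (z : nat)) ->
  size s1 + size s2 <= (size (X :: Xs) + size (Y :: Ys)) * K.
  move=> {D s0 hz hz' sX sY pX pY cXY sz X Y}.
  move=> {}z X {}Xs Y {}Ys {}g {}g' s1 s2 sz pX pY cXY c1 sX sY.
  have s1K : size s1 <= K by apply: cXY c1; rewrite inE eqxx.
  move: (pX) (pY) => /= /andP[pX1 pXs] /andP[pY1 pYs].
  have cXYs X' Y' t : X' \in Xs -> Y' \in Ys -> common t X' Y' -> size t <= K.
    by move=> xX yY; apply: cXY; rewrite inE (xX, yY) orbT.
  have [->|s20] := eqVneq s2 [::]; first by clear -s1K; rewrite /= addn0; nia.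
  have [hs|hz1] := eqVneq (head 0 s2) (z : nat).
    move: sY => /subseq_skip; rewrite hs plain_bool // => /(_ isT) /subseq_skip.
    rewrite hs mem_nseq (negPf (notb z)) andbF => /(_ isT) sY.
    have [b [s3 [es bK s3X]]] := subseq_nseq_cat sX.
    have : size s3 <= (size Xs + size Ys) * K.
      apply: (IHn z _ _ K K g g') => //; first by clear -sz; move: sz => /=; lia.
      rewrite /select negbK; apply: subseq_trans sY.
      by rewrite es suffix_subseq.
    (* Two blocks are dropped: one pays for [s1], the other for the [b] separator symbols. *)
    by rewrite es size_cat size_nseq /=; clear -s1K bK; nia.
  have [hs|hz2] := eqVneq (head 0 s2) (~~ z : nat).
    move: sX => /subseq_skip; rewrite hs mem_nseq eq_sym (negPf (notb z)) andbF.
    move=> /(_ isT) sX.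
    move: sY => /subseq_skip; rewrite hs plain_bool // => /(_ isT).
    move=> /subseq_nseq_cat [b [s3 [es bK s3Y]]].
    have : size s3 <= (size Xs + size Ys) * K.
      apply: (IHn z _ _ K K g g') => //; first by clear -sz; move: sz => /=; lia.
        by apply: subseq_trans sX; rewrite es suffix_subseq.
      by rewrite /select negbK.
    by rewrite es size_cat size_nseq /=; clear -s1K bK; nia.
  (* The remaining word starts with a gadget symbol, so it passes the whole separator after [X].
     Only [X] is dropped, and it pays for [s1]. *)
  move: sX => /subseq_skip; rewrite mem_nseq (negPf hz1) andbF => /(_ isT).
  move=> /subseq_skip; rewrite mem_nseq (negPf hz2) andbF => /(_ isT) sX.
  have : size s2 <= (size Xs + size (Y :: Ys)) * K.
    apply: (IHn z _ _ 0 0 g g') => //.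
      by move=> X' Y' t xX; apply: cXY; rewrite inE xX orbT.
    by rewrite /select negbK blocks_cons negbK -!catA.
  by clear -s1K => /=; nia.
have {}sX : subseq s (X ++ nseq K (z : nat) ++ nseq K (~~ z : nat) ++
                      blocks z Xs ++ nseq g (~~ z : nat)).
  move: sX; rewrite /select => /subseq_skip; rewrite mem_nseq (negPf hz') andbF.
  by move=> /(_ isT); rewrite blocks_cons -!catA.
have {}sY : subseq s (Y ++ nseq K (~~ z : nat) ++ nseq K (z : nat) ++
                      blocks (~~ z) Ys ++ nseq g' (z : nat)).
  move: sY; rewrite /select negbK => /subseq_skip; rewrite mem_nseq (negPf hz) andbF.
  by move=> /(_ isT); rewrite blocks_cons negbK -!catA.
have [s1 [s2 [es sX1 sX2]]] := subseq_cat_split sX.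
have [t1 [t2 [et tY1 tY2]]] := subseq_cat_split sY.
(* The cuts of [s] after [X] and after [Y] may differ. The block with the earlier cut takes the
   place of [X] in [E]. *)
have := et; rewrite es => /cat_eq_cat [] [r [e1 e2]]; rewrite size_cat.
- apply: (E z X Xs Y Ys g g') => //.
    by rewrite /common sX1 (subseq_trans _ tY1) // e1 prefix_subseq.
  by rewrite e2 cat_subseq // (subseq_trans _ tY1) // e1 suffix_subseq.
- have := E (~~ z) Y Ys X Xs g' g t1 t2; rewrite negbK => E'.
  have -> : size s1 + size s2 = size t1 + size t2 by rewrite -!size_cat -es et.
  rewrite addnC [X in _ <= X * _]addnC addnC; apply: E' => //.
  - by rewrite addnC.
  - by move=> X' Y' t xX yY; rewrite /common andbC; apply: cXY.
  - by rewrite /common tY1 (subseq_trans _ sX1) // e1 prefix_subseq.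
  by rewrite e2 cat_subseq // (subseq_trans _ sX1) // e1 suffix_subseq.
Qed.

Definition rep (b : nat) (w : seq nat) := flatten (nseq b w).

Lemma repS b w : rep b.+1 w = w ++ rep b w. Proof. by []. Qed.

Lemma rep_rot b (c d : seq nat) : d ++ rep b (c ++ d) = rep b (d ++ c) ++ d.
Proof. by elim: b => [|b IHb]; rewrite ?cats0 // !repS -!catA IHb. Qed.

Lemma repD a b w : rep (a + b) w = rep a w ++ rep b w.
Proof. by elim: a => //= a IHa; rewrite addSn !repS IHa catA. Qed.

Lemma size_rep b w : size (rep b w) = b * size w.
Proof. by elim: b => //= b IHb; rewrite repS size_cat IHb mulSn. Qed.

Lemma rep_nseq b (x : nat) : rep b (nseq K x) = nseq (b * K) x.
Proof. by elim: b => //= b IHb; rewrite repS IHb cat_nseq /ncons -iterD. Qed.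

Lemma rep_blocks z Xs : subseq (rep (size Xs) (sep z)) (blocks z Xs).
Proof.
elim: Xs => //= X Xs IH; rewrite repS /blocks /= cat_subseq //.
by rewrite suffix_subseq.
Qed.

Lemma subseq_rep b (v w : seq nat) : subseq v w -> subseq (rep b v) (rep b w).
Proof. by move=> vw; elim: b => //= b IHb; rewrite !repS cat_subseq. Qed.

Lemma subseq_nseq a b (x : nat) : a <= b -> subseq (nseq a x) (nseq b x).
Proof. by move=> ab; rewrite -(subnKC ab) nseqD prefix_subseq. Qed.

Lemma left_word a b (c d : seq nat) :
  subseq (rep a c ++ rep b (d ++ c)) (d ++ rep (a + b) (c ++ d)).
Proof.
elim: a => [|a IHa]; first by rewrite add0n rep_rot prefix_subseq.
rewrite addSn !repS -!catA; apply: subseq_trans (suffix_subseq d _).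
by rewrite cat_subseq.
Qed.

(** The word c^((a-b)K) (d^K c^K)^b uses every separator c of the side with more blocks and every
    separator d of the other. Surplus c's are matched in a margin, and so is the first d^K if a =
    b. *)
Lemma select_left z Xs Ys e f : size Ys <= size Xs -> K <= e ->
  size Xs * K <= f ->
  exists2 s, size s = (size Xs + size Ys) * K &
    common s (nseq e (~~ z : nat) ++ blocks z Xs)
             (nseq f (z : nat) ++ blocks (~~ z) Ys).
Proof.
move=> le_ab Ke bf; set a := size Xs; set b := size Ys.
pose c := nseq K (z : nat); pose d := nseq K (~~ z : nat).
exists (rep (a - b) c ++ rep b (d ++ c)).
  by rewrite size_cat !size_rep size_cat !size_nseq /a /b; nia.
apply/andP; split.
  apply: subseq_trans (left_word _ _ _ _) _; rewrite subnK //.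
  by rewrite cat_subseq ?subseq_nseq // rep_blocks.
rewrite cat_subseq //; last by have <- : sep (~~ z) = d ++ c; rewrite ?rep_blocks // /sep negbK.
by rewrite rep_nseq subseq_nseq //; nia.
Qed.

(** Here the separators after the matched pair are included. The word (c^K d^K)^b c^((a-b+1)K) gives
    up only the d^K that directly follows the matched block of the second side; this is the loss of
    K per matched pair. *)
Lemma select_right z Xs Ys g g' : size Ys <= size Xs ->
  (size Xs).+1 * K <= g' ->
  exists2 s, size s = (size Xs + size Ys).+1 * K &
    common s (sep z ++ blocks z Xs ++ nseq g (~~ z : nat))
             (sep (~~ z) ++ blocks (~~ z) Ys ++ nseq g' (z : nat)).
Proof.
move=> le_ab bf; set a := size Xs; set b := size Ys.
pose c := nseq K (z : nat); pose d := nseq K (~~ z : nat).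
exists (rep b (c ++ d) ++ rep (a - b).+1 c).
  by rewrite size_cat !size_rep size_cat !size_nseq /a /b; nia.
apply/andP; split.
  rewrite catA -[rep b _ ++ _]cats0 cat_subseq ?sub0seq //.
  have -> : sep z ++ blocks z Xs = blocks z ([::] :: Xs) by [].
  apply: subseq_trans (rep_blocks _ _); rewrite /= -/a.
  have -> : a.+1 = b + (a - b).+1 by lia.
  rewrite repD cat_subseq // subseq_rep // /sep.
  by rewrite prefix_subseq.
rewrite /sep negbK -/c -/d rep_nseq -catA.
apply: subseq_trans (suffix_subseq d _).
apply: (@subseq_trans _ (c ++ rep b (d ++ c) ++ nseq g' (z : nat))); last first.
  rewrite !cat_subseq //.
  by have <- : sep (~~ z) = d ++ c; rewrite ?rep_blocks // /sep negbK.
rewrite catA rep_rot -catA cat_subseq //.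
by rewrite [c ++ _]cat_nseq /ncons -iterD subseq_nseq //; nia.
Qed.

Lemma select_lower Xs1 X Xs2 Ys1 Y Ys2 t P g :
  size Xs1 + size Xs2 < P -> size Ys1 + size Ys2 < P -> P * K <= g ->
  common t X Y ->
  exists2 s, size s = (size Xs1 + size Ys1 + size Xs2 + size Ys2).+1 * K + size t
    & common s (select false g g (Xs1 ++ X :: Xs2))
               (select true g g (Ys1 ++ Y :: Ys2)).
Proof.
move=> XP YP Pg ctXY.
have [s1 es1 c1] : exists2 s, size s = (size Xs1 + size Ys1) * K &
    common s (nseq g 1 ++ blocks false Xs1) (nseq g 0 ++ blocks true Ys1).
  have [le|/ltnW le] := leqP (size Ys1) (size Xs1).
    by apply: select_left => //; nia.
  rewrite addnC; have [||s es] := @select_left true _ _ g g le; try by nia.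
  by rewrite /common andbC; exists s.
have [s2 es2 c2] : exists2 s, size s = (size Xs2 + size Ys2).+1 * K &
    common s (sep false ++ blocks false Xs2 ++ nseq g 1)
             (sep true ++ blocks true Ys2 ++ nseq g 0).
  have [le|/ltnW le] := leqP (size Ys2) (size Xs2).
    by apply: select_right => //; nia.
  rewrite addnC; have [|s es] := @select_right true _ _ g g le; first by nia.
  by rewrite /common andbC; exists s.
exists (s1 ++ t ++ s2); first by rewrite !size_cat es1 es2; lia.
move: c1 c2 ctXY => /andP[a1 b1] /andP[a2 b2] /andP[a3 b3].
rewrite /common /select /blocks !map_cat !flatten_cat /= -!catA.
rewrite (catA (nseq g _)) (catA (nseq g (0 : nat))) !cat_subseq //.
  by move: b2; rewrite {1}/sep -!catA.
by move: a2; rewrite {1}/sep -!catA.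
Qed.

End Selection.

(** * Branching programs as walks *)

Section Walk.
Variables (W : nat) (edge : nat -> nat -> nat -> bool).

Fixpoint walk (n i u v : nat) : bool :=
  if n is n'.+1 then has (fun m => edge i u m && walk n' i.+1 m v) (iota 0 W)
  else u == v.

Lemma has_iotaP (p : pred nat) :
  reflect (exists2 m, m < W & p m) (has p (iota 0 W)).
Proof.
apply: (iffP hasP) => [] [m mW pm]; exists m => //; move: mW;
by rewrite mem_iota.
Qed.

Lemma walkD a b i u v : u < W ->
  walk (a + b) i u v = has (fun m => walk a i u m && walk b (i + a) m v) (iota 0 W).
Proof.
elim: a i u => [|a IHa] i u uW.
  rewrite add0n addn0 /=; apply/idP/has_iotaP => [w|[m _ /andP[/eqP-> //]]].
  by exists u; rewrite ?eqxx.
rewrite addSn /=; apply/has_iotaP/has_iotaP => [] [m mW /andP[]].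
  move=> e; rewrite IHa // => /has_iotaP [m' m'W /andP[w1 w2]].
  exists m' => //; rewrite addnS -addSn w2 andbT.
  by apply/has_iotaP; exists m => //; rewrite e.
move=> /has_iotaP [m' m'W /andP[e w1] w2]; exists m' => //; rewrite e IHa //=.
by apply/has_iotaP; exists m => //; rewrite w1 addSn -addnS.
Qed.

Lemma reach_walk k i u v : u < W -> v < W ->
  reach W edge k i u v = walk (2 ^ k) (i * 2 ^ k) u v.
Proof.
elim: k i u v => [|k IHk] i u v uW vW.
  rewrite expn0 muln1 /=; apply/idP/has_iotaP => [e|[m _ /andP[e /eqP<-]]] //.
  by exists v; rewrite ?e ?eqxx.
rewrite expnS mul2n -addnn walkD //=; apply: eq_in_has => m.
rewrite mem_iota => mW; rewrite !IHk //; congr (walk _ _ _ _ && walk _ _ _ _); lia.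
Qed.

Lemma walk_stay n i u v : u < W -> v < W ->
  (forall j u' v', i <= j -> edge j u' v' = (u' == v')) ->
  walk n i u v = (u == v).
Proof.
move=> uW vW; elim: n i u uW => [|n IHn] i u uW stay //=.
apply/has_iotaP/eqP => [[m mW]|uv].
  rewrite stay // IHn // => [/andP[/eqP-> /eqP //]|j u' v' ij].
  by rewrite stay // ltnW.
exists u; rewrite // stay // eqxx IHn // ?uv ?eqxx // => j u' v' ij.
by rewrite stay // ltnW.
Qed.
End Walk.

Lemma walkS W edge n i u v : walk W edge n.+1 i u v =
  has (fun m => edge i u m && walk W edge n i.+1 m v) (iota 0 W).
Proof. by []. Qed.

Lemma eq_walk W e e' n i u v : u < W ->
  (forall j u' v', j < i + n -> u' < W -> v' < W -> e j u' v' = e' j u' v') ->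
  walk W e n i u v = walk W e' n i u v.
Proof.
elim: n i u => [|n IHn] i u // uW ee'; rewrite !walkS; apply: eq_in_has => m.
rewrite mem_iota => mW.
rewrite ee' //; last by lia.
by rewrite IHn // => j u' v' ji; apply: ee'; lia.
Qed.

Lemma nth_flatten_uniform (S I : Type) (g : I -> seq S) (r : seq I) b x0 y0 i j :
  (forall y, size (g y) = b) -> i < size r -> j < b ->
  nth x0 (flatten [seq g y | y <- r]) (i * b + j) = nth x0 (g (nth y0 r i)) j.
Proof.
move=> gb; elim: r i => // y r IHr [|i] /= ir jb; rewrite nth_cat gb.
  by rewrite mul0n jb.
by rewrite ifF ?mulSn -?addnA ?addKn ?IHr //; apply/negP; lia.
Qed.

Lemma size_flatten_uniform (S I : Type) (g : I -> seq S) (r : seq I) b :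
  (forall y, size (g y) = b) -> size (flatten [seq g y | y <- r]) = size r * b.
Proof.
by move=> gb; elim: r => //= y r IHr; rewrite size_cat IHr gb mulSn.
Qed.

Lemma nat_bits (f : nat -> bool) h :
  exists2 a, a < 2 ^ h & forall j, j < h -> odd (a %/ 2 ^ j) = f j.
Proof.
elim: h f => [|h IHh] f; first by exists 0.
have [a ah fa] := IHh (fun j => f j.+1).
exists (f 0 + a.*2); first by rewrite expnS; case: (f 0); lia.
case=> [|j] jh.
  by rewrite expn0 divn1 oddD odd_double addbF oddb.
rewrite expnS divnMA -fa //; congr (odd (_ %/ _)).
by rewrite divn2 halfD odd_double andbF doubleK; case: (f 0).
Qed.

(** * The two LCS sequences of a branching program *)

Section Reduction.
Variables (mem : nat -> nat) (T W h : nat).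

(** Address in [bp_encoding]: three header cells, T-1 labels, then two cells for each layer, tail
    and head. *)
Definition edge_cell (i u v b : nat) : nat := 3 + T.-1 + 2 * ((i * W + u) * W + v) + b.

(* On the [z] side, an edge whose label belongs to the other half of the
   variables counts as present; the layers past the last one are padded with
   identity edges. *)
Definition present (z : bool) (a i u v : nat) : bool :=
  if i < T.-1 then
    if (mem (3 + i) < h) == z then true
    else mem (edge_cell i u v
           ((a %/ 2 ^ (mem (3 + i) - (if z then h else 0))) %% 2)) != 0
  else u == v.

Let k := up_log 2 T.
Let K := (2 ^ k).-1.

Definition gadget (z : bool) (a : nat) : seq nat :=
  leaves W (leaf_symbol (present z a) z) z k 0 0 0 0.

Definition lcs_side (z : bool) : seq nat :=
  select K z (2 ^ h * K) (2 ^ h * K) [seq gadget z a | a <- iota 0 (2 ^ h)].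

Lemma size_gadget z a : size (gadget z a) = W.*2 ^ k.
Proof. exact: size_leaves. Qed.

Lemma size_lcs_side z : size (lcs_side z) = 2 ^ h * (W.*2 ^ k + 4 * K).
Proof.
rewrite /lcs_side /select !size_cat !size_nseq /blocks -map_comp.
rewrite (@size_flatten_uniform _ _ _ _ (W.*2 ^ k + 2 * K)) => [|a].
  by rewrite size_iota; lia.
by rewrite /= size_cat size_gadget /sep size_cat !size_nseq; lia.
Qed.

Lemma plain_gadget z a : plain (gadget z a).
Proof. by apply/allP => y /leaves_range [->|]; lia. Qed.

(** Without an accepting pair every gadget pair has LCS at most [K], and [select_upper] gives 2PK.
    An accepting pair gives (2P-1)K + 2^k = 2PK + 1. *)
Lemma lcs_sides_reach :
  (exists2 s, common s (lcs_side false) (lcs_side true) &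
     2 * (2 ^ h * K) < size s) <->
  (exists a b, [/\ a < 2 ^ h, b < 2 ^ h &
     reach W (fun i u v => present false a i u v && present true b i u v) k 0 0 0]).
Proof.
have k2 : 0 < 2 ^ k by rewrite expn_gt0.
split=> [[s /andP[sx sy]] sP|[a [b [aP bP]]]].
- pose ok a b := reach W
    (fun i u v => present false a i u v && present true b i u v) k 0 0 0.
  have [/existsP[a /existsP[b r]]|] :=
    boolP [exists a : 'I_(2 ^ h), exists b : 'I_(2 ^ h), ok a b].
    by exists a, b; split.
  move=> /existsPn no; suff : size s <= (2 ^ h + 2 ^ h) * K by lia.
  have := @select_upper K _ false [seq gadget false a | a <- iota 0 (2 ^ h)]
    [seq gadget true a | a <- iota 0 (2 ^ h)] _ _ _ _ s (leqnn _) _ _ _ sx sy.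
  rewrite !size_map !size_iota; apply.
  + by apply/allP => X /mapP [a _ ->]; apply: plain_gadget.
  + by apply/allP => X /mapP [a _ ->]; apply: plain_gadget.
  move=> X Y t /mapP [a]; rewrite mem_iota => aP -> /mapP [b].
  rewrite mem_iota => bP -> /leaves_upper [le rt].
  have := no (Ordinal (aP : a < 2 ^ h)) => /existsPn /(_ (Ordinal (bP : b < 2 ^ h))) /= nr.
  suff : size t != 2 ^ k by rewrite /K; lia.
  by apply: contraNneq nr => /rt.
- move=> /(@leaves_lower _ _ _ _ _ _ _ 0) [t st ct].
  have sp c : c < 2 ^ h -> forall z, [seq gadget z a | a <- iota 0 (2 ^ h)] =
    [seq gadget z a | a <- iota 0 c] ++ gadget z c ::
    [seq gadget z a | a <- iota c.+1 (2 ^ h - c.+1)].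
    move=> cP z; have e : 2 ^ h = c + (2 ^ h - c.+1).+1 by lia.
    by rewrite {1}e iotaD map_cat.
  have [||s es cs] := @select_lower K [seq gadget false a | a <- iota 0 a]
    (gadget false a) [seq gadget false a | a <- iota a.+1 (2 ^ h - a.+1)]
    [seq gadget true a | a <- iota 0 b]
    (gadget true b) [seq gadget true a | a <- iota b.+1 (2 ^ h - b.+1)]
    t (2 ^ h) (2 ^ h * K) _ _ (leqnn _) ct.
  + by rewrite !size_map !size_iota; lia.
  + by rewrite !size_map !size_iota; lia.
  exists s; first by rewrite /lcs_side (sp a) // (sp b).
  rewrite es !size_map !size_iota st.
  have -> : a + b + (2 ^ h - a.+1) + (2 ^ h - b.+1) = (2 ^ h + 2 ^ h).-2 by lia.
  have : 2 ^ k = K.+1 by rewrite /K; lia.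
  have : 0 < 2 ^ h by rewrite expn_gt0.
  nia.
Qed.
End Reduction.

(** * Encoded branching programs and their walks *)

Section BPEncoding.
Variable B : bp.
Let T := bp_length B.
Let W := bp_width B.
Let n := bp_vars B.
Let mem := nth 0 (bp_encoding B).

Lemma enc_body j : mem (3 + j) =
  nth 0 ([seq (bp_label i : nat) | i <- enum 'I_T.-1] ++
    flatten [seq flatten [seq flatten [seq
        [:: nat_of_bool (bp_edge i u v false); nat_of_bool (bp_edge i u v true)]
      | v <- enum 'I_W] | u <- enum 'I_W] | i <- enum 'I_T.-1]) j.
Proof. by []. Qed.

Lemma enc_label (i : 'I_T.-1) : mem (3 + i) = bp_label i.
Proof.
rewrite enc_body nth_cat size_map size_enum_ord ltn_ord.
by rewrite (nth_map i) ?size_enum_ord // nth_ord_enum.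
Qed.

Lemma enc_edge (i : 'I_T.-1) (u v : 'I_W) (b : bool) :
  mem (edge_cell T W i u v b) = bp_edge i u v b.
Proof.
rewrite /edge_cell -!addnA enc_body nth_cat size_map size_enum_ord ifF; last first.
  by apply/negP; lia.
rewrite (_ : _ - _ = i * (W * (W * 2)) + (u * (W * 2) + (v * 2 + b))); last by lia.
have vb : v * 2 + b < W * 2 by case: b; have := ltn_ord v; lia.
rewrite (@nth_flatten_uniform _ _ _ _ _ _ i) ?size_enum_ord //.
- rewrite nth_ord_enum (@nth_flatten_uniform _ _ _ _ _ _ u) ?size_enum_ord //.
    rewrite nth_ord_enum (@nth_flatten_uniform _ _ _ _ _ _ v) ?size_enum_ord //.
      by rewrite nth_ord_enum; clear vb; case: b.
    by clear vb; case: b.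
  by move=> y; rewrite (@size_flatten_uniform _ _ _ _ 2) // size_enum_ord.
- move=> y; rewrite (@size_flatten_uniform _ _ _ _ (W * 2)) ?size_enum_ord // => y'.
  by rewrite (@size_flatten_uniform _ _ _ _ 2) // size_enum_ord.
- by have := ltn_ord u; nia.
Qed.

Lemma size_bp_encoding : size (bp_encoding B) = 3 + T.-1 + 2 * (T.-1 * W * W).
Proof.
rewrite /bp_encoding !size_cat size_map size_enum_ord /=.
rewrite (@size_flatten_uniform _ _ _ _ (W * (W * 2))) ?size_enum_ord //.
  by rewrite -/T -/W; lia.
move=> y; rewrite (@size_flatten_uniform _ _ _ _ (W * 2)) ?size_enum_ord // => y'.
by rewrite (@size_flatten_uniform _ _ _ _ 2) // size_enum_ord.
Qed.

Variable x : {ffun 'I_n -> bool}.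

Definition bp_edge_nat (i u v : nat) : bool :=
  if insub i is Some i then
    if insub u is Some u then
      if insub v is Some v then bp_edge (b := B) i u v (x (bp_label i)) else false
    else false
  else false.

Lemma bp_edge_natE (i : 'I_T.-1) (u v : 'I_W) :
  bp_edge_nat i u v = bp_edge i u v (x (bp_label i)).
Proof. by rewrite /bp_edge_nat !valK. Qed.

Lemma bp_accepts_walk :
  bp_accepts x = walk W bp_edge_nat T.-1 0 0 0.
Proof.
apply/idP/idP => [/connectP [p]|].
  (* Each step raises the layer by one, so a path to the accept node has exactly T-1 edges. *)
  have : forall u, path (bp_step x) u p -> forall v, v = last u p ->
    v.1 = u.1 + size p :> nat /\ walk W bp_edge_nat (size p) u.1 u.2 v.2.
    elim: p => [|u' p IHp] u /=; first by move=> _ v ->; rewrite addn0 eqxx.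
    case/andP=> /existsP [i /and3P[/eqP e1 /eqP e2 e]] /IHp {}IHp v /IHp [ev w].
    split; first by rewrite ev e1 e2 addSnnS.
    apply/hasP; exists (u'.2 : nat); first by rewrite mem_iota /=.
    by rewrite e1 bp_edge_natE e -e2.
  by move=> h /h{}h /h [/= e]; rewrite add0n in e; rewrite -e.
have : forall m i u v (uW : u < W) (vW : v < W) (iT : i < T) (jT : i + m < T),
   walk W bp_edge_nat m i u v ->
   connect (bp_step x) ((Ordinal iT, Ordinal uW) : bp_node B)
                       ((Ordinal jT, Ordinal vW) : bp_node B).
  elim=> [|m IHm] i u v uW vW iT jT /=.
    move=> /eqP uv; rewrite (_ : (Ordinal jT, _) = (Ordinal iT, Ordinal uW)) //.
    by congr (_, _); apply: val_inj => //=; rewrite addn0.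
  case/hasP=> u'; rewrite mem_iota => u'W /andP[e w].
  have i1T : i.+1 < T by lia.
  have jT' : i.+1 + m < T by lia.
  have c := IHm i.+1 u' v u'W vW i1T jT' w.
  rewrite (_ : Ordinal jT = Ordinal jT'); last by apply: val_inj; rewrite /= addnS.
  apply: connect_trans c; apply: connect1; apply/existsP.
  have iT1 : i < T.-1 by lia.
  exists (Ordinal iT1); rewrite /= !eqxx /=.
  by rewrite -bp_edge_natE.
move=> h w; have T0 := bp_length_gt0 B.
rewrite /bp_accepts (_ : bp_accept B = (Ordinal (bp_last_subproof B : 0 + T.-1 < T),
  Ordinal (bp_width_gt0 B)) :> bp_node B); first exact: h.
by congr (_, _); apply: val_inj.
Qed.

(** The formula describes walks of length 2^k, at least T-1. Beyond the last layer only identity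
    edges remain, so such a walk ends in node 0 iff it is in node 0 at layer T-1. *)
Lemma bp_accepts_reach hh a b : n <= hh.*2 ->
  (forall j : 'I_n, x j = if j < hh then odd (a %/ 2 ^ j) else odd (b %/ 2 ^ (j - hh))) ->
  bp_accepts x = reach W (fun i u v =>
    present mem T W hh false a i u v && present mem T W hh true b i u v)
    (up_log 2 T) 0 0 0.
Proof.
move=> nh xab; have W0 := bp_width_gt0 B.
rewrite reach_walk // mul0n bp_accepts_walk.
have Tk : T.-1 <= 2 ^ up_log 2 T.
  by apply: leq_trans (leq_pred _) (up_logP _ _).
rewrite -(subnKC Tk) walkD // add0n.
set e := fun i u v : nat => _ && _.
have -> : walk W bp_edge_nat T.-1 0 0 0 = walk W e T.-1 0 0 0.
  apply: eq_walk => // i u v; rewrite add0n => iT uW vW.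
  rewrite /e /present iT (enc_label (Ordinal iT)).
  rewrite (bp_edge_natE (Ordinal iT) (Ordinal uW) (Ordinal vW)) xab.
  case: ltnP => jh; rewrite /= ?subn0 modn2.
    by rewrite (enc_edge (Ordinal iT) (Ordinal uW) (Ordinal vW)) andbT; case: (bp_edge _ _ _ _).
  by rewrite (enc_edge (Ordinal iT) (Ordinal uW) (Ordinal vW)); case: (bp_edge _ _ _ _).
apply/idP/has_iotaP => [w|[m mW]].
  exists 0; rewrite // w walk_stay // => j u' v' ij.
  by rewrite /e /present ltnNge ij andbb.
rewrite (@walk_stay W e _ T.-1) // => [/andP[w /eqP m0]|j u' v' ij].
  by move: w; rewrite m0.
by rewrite /e /present ltnNge ij andbb.
Qed.
End BPEncoding.

Lemma sat_lcs_sides (B : bp) (h : nat) : bp_vars B <= h.*2 ->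
  bp_satisfiable B <->
  exists2 s, let side := lcs_side (nth 0 (bp_encoding B)) (bp_length B) (bp_width B) h in
     common s (side false) (side true) &
     2 * (2 ^ h * (2 ^ up_log 2 (bp_length B)).-1) < size s.
Proof.
move=> nh; rewrite /= lcs_sides_reach; split=> [/existsP[x]|[a [b [aP bP r]]]].
  (* If n is odd, the second half has one index without a variable; it receives false. *)
  pose f (j : nat) := if insub j is Some i then x i else false.
  have [a aP fa] := nat_bits f h; have [b bP fb] := nat_bits (fun j => f (h + j)) h.
  have xab (j : 'I_(bp_vars B)) :
    x j = if j < h then odd (a %/ 2 ^ j) else odd (b %/ 2 ^ (j - h)).
    have fj : x j = f j by rewrite /f valK.
    case: ltnP => jh; first by rewrite fa.
    by rewrite fb ?subnKC // ltn_subLR // addnn; apply: leq_trans nh.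
  by rewrite (bp_accepts_reach nh xab); exists a, b.
apply/existsP; exists [ffun j : 'I_(bp_vars B) =>
  if j < h then odd (a %/ 2 ^ j) else odd (b %/ 2 ^ (j - h))].
by rewrite (@bp_accepts_reach _ _ h a b) // => j; rewrite ffunE.
Qed.

(** * Word RAM executions *)

Section Machine.
Variable w : nat.

Lemma exec_det c s t1 s1 : exec w c s t1 s1 ->
  forall t2 s2, exec w c s t2 s2 -> t1 = t2 /\ s1 = s2.
Proof.
have nz s0 r0 : regs s0 r0 = 0 -> regs s0 r0 != 0 -> False by move=> ->.
elim=> {c s t1 s1} => *; match goal with H : exec _ _ _ _ _ |- _ =>
  move: H; repeat match goal with H' : exec _ _ _ _ _ |- _ => clear H' end;
  move=> H; inversion H; subst; clear H end;
repeat match goal with IH : forall t s, exec w ?c ?s0 t s -> _,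
    H : exec w ?c ?s0 _ _ |- _ =>
  have [? ?] := IH _ _ H; subst; clear IH H end; solve [by split | exfalso; eauto].
Qed.

(** A run of [t] steps loads from at most [t] cells, collected in [A]; changing any other cell
    leaves the registers as they were. The last clause, that agreeing cells still agree at the end,
    is what makes sequencing work. *)
Lemma exec_reads c s t s' : exec w c s t s' ->
  exists2 A : seq nat, size A <= t & forall s2,
    regs s2 = regs s -> (forall a, a \in A -> memory s2 a = memory s a) ->
    exists s2', [/\ exec w c s2 t s2', regs s2' = regs s' &
      forall a, memory s2 a = memory s a -> memory s2' a = memory s' a].
Proof.
elim=> {c s t s'}.
- by move=> s; exists [::] => // s2 e _; exists s2; split=> //; constructor.
- move=> s r v; exists [::] => // s2 e _; eexists; split; first by constructor.
    by rewrite /= e.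
  by [].
- move=> s o r r1 r2; exists [::] => // s2 e _; eexists; split; first by constructor.
    by rewrite /= e.
  by [].
- move=> s r a; exists [:: regs s a] => // s2 e ea; eexists; split; first by constructor.
    by rewrite /= e ea // inE.
  by [].
- move=> s a r; exists [::] => // s2 e _; eexists; split; first by constructor.
    by [].
  by move=> b; rewrite /= /update e; case: eqP.
- move=> c1 c2 s1 s2 s3 t1 t2 _ [A1 sA1 IH1] _ [A2 sA2 IH2].
  exists (A1 ++ A2); first by rewrite size_cat leq_add.
  move=> z ez eA.
  have [|z1 [x1 e1 m1]] := IH1 z ez; first by move=> a aA; apply: eA; rewrite mem_cat aA.
  have [|z2 [x2 e2 m2]] := IH2 z1 e1.
    by move=> a aA; apply/m1/eA; rewrite mem_cat aA orbT.
  exists z2; split=> //; first by econstructor; eassumption.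
  by move=> a /m1 /m2.
- move=> s r c1 c2 s' t nz _ [A sA IH]; exists A => [|z ez /IH - /(_ ez)]; first exact: leqW.
  by move=> [z2 [x e m]]; exists z2; split=> //; apply: ExecIfTrue; rewrite ?ez.
- move=> s r c1 c2 s' t nz _ [A sA IH]; exists A => [|z ez /IH - /(_ ez)]; first exact: leqW.
  by move=> [z2 [x e m]]; exists z2; split=> //; apply: ExecIfFalse; rewrite ?ez.
- move=> r c s1 s2 s3 t1 t2 nz _ [A1 sA1 IH1] _ [A2 sA2 IH2].
  exists (A1 ++ A2); first by rewrite size_cat leqW // leq_add.
  move=> z ez eA.
  have [|z1 [x1 e1 m1]] := IH1 z ez; first by move=> a aA; apply: eA; rewrite mem_cat aA.
  have [|z2 [x2 e2 m2]] := IH2 z1 e1.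
    by move=> a aA; apply/m1/eA; rewrite mem_cat aA orbT.
  exists z2; split=> //; first by econstructor; try eassumption; rewrite ez.
  by move=> a /m1 /m2.
- move=> r c s z; exists [::] => // s2 e _; exists s2; split=> //.
  by apply: ExecWhileFalse; rewrite e.
Qed.

Fixpoint reg_bound (c : cmd) : nat :=
  match c with
  | CSkip => 0
  | CConst r _ => r.+1
  | COp _ r r1 r2 => maxn r.+1 (maxn r1.+1 r2.+1)
  | CLoad r a => maxn r.+1 a.+1
  | CStore a r => maxn a.+1 r.+1
  | CSeq c1 c2 => maxn (reg_bound c1) (reg_bound c2)
  | CIf r c1 c2 => maxn r.+1 (maxn (reg_bound c1) (reg_bound c2))
  | CWhile r c => maxn r.+1 (reg_bound c)
  end.

Definition agree m (s s2 : state) :=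
  (forall r, r < m -> regs s2 r = regs s r) /\ memory s2 = memory s.

(** Lets the LCS program, specified from all-zero registers, run while the registers from [m] on
    hold the variables of the reduction. *)
Lemma exec_regs m c s t s' : exec w c s t s' -> reg_bound c <= m ->
  forall s2, agree m s s2 ->
  exists s2', [/\ exec w c s2 t s2', agree m s' s2' &
    forall r, m <= r -> regs s2' r = regs s2 r].
Proof.
have agree_set z z2 r v : r < m -> agree m z z2 ->
    agree m (set_reg z r v) (set_reg z2 r v) /\
    forall r', m <= r' -> regs (set_reg z2 r v) r' = regs z2 r'.
  move=> rm [e em]; split; first split=> //= r' r'm.
    by rewrite /update; case: eqP => // _; apply: e.
  by move=> r' mr; rewrite /= /update; case: eqP => // e'; lia.
elim=> {c s t s'}.
- by move=> s _ s2 e; exists s2; split=> //; constructor.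
- move=> s r v /= rm s2 /(agree_set _ _ _ (v %% 2 ^ w) rm) [a1 a2].
  by eexists; split; first by constructor.
- move=> s o r r1 r2; rewrite /= !geq_max => /andP[rm /andP[r1m r2m]] s2 a.
  have [a1 a2] := agree_set _ _ _ (eval_binop w o (regs s r1) (regs s r2)) rm a.
  eexists; split; first by constructor.
    by rewrite !(proj1 a).
  by rewrite !(proj1 a).
- move=> s r a; rewrite /= !geq_max => /andP[rm am] s2 e.
  have [a1 a2] := agree_set _ _ _ (memory s (regs s a)) rm e.
  eexists; split; first by constructor.
    by case: e => [e ->]; rewrite e.
  by case: e => [e ->]; rewrite e.
- move=> s a r; rewrite /= !geq_max => /andP[am rm] s2 [e em].
  eexists; split; first by constructor.
    by split=> //=; rewrite !e // em.
  by [].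
- move=> c1 c2 s1 s2 s3 t1 t2 _ IH1 _ IH2; rewrite /= geq_max => /andP[b1 b2] z a.
  have [z1 [x1 a1 f1]] := IH1 b1 _ a; have [z2 [x2 a2 f2]] := IH2 b2 _ a1.
  exists z2; split=> //; first by econstructor; eassumption.
  by move=> r mr; rewrite f2 ?f1.
- move=> s r c1 c2 s' t nz _ IH; rewrite /= !geq_max => /andP[rm /andP[b1 b2]] z a.
  have [z1 [x1 a1 f1]] := IH b1 _ a; exists z1; split=> //.
  by apply: ExecIfTrue => //; rewrite (proj1 a).
- move=> s r c1 c2 s' t nz _ IH; rewrite /= !geq_max => /andP[rm /andP[b1 b2]] z a.
  have [z1 [x1 a1 f1]] := IH b2 _ a; exists z1; split=> //.
  by apply: ExecIfFalse => //; rewrite (proj1 a).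
- move=> r c s1 s2 s3 t1 t2 nz _ IH1 _ IH2 bb; move: (bb).
  rewrite /= geq_max => /andP[rm b1] z a.
  have [z1 [x1 a1 f1]] := IH1 b1 _ a; have [z2 [x2 a2 f2]] := IH2 bb _ a1.
  exists z2; split=> //; first by econstructor; try eassumption; rewrite (proj1 a).
  by move=> r' mr; rewrite f2 ?f1.
- move=> r c s z; rewrite /= geq_max => /andP[rm _] s2 a; exists s2; split=> //.
  by apply: ExecWhileFalse; rewrite (proj1 a).
Qed.

End Machine.

(** * A compiler for expressions and bounded loops *)

Inductive expr :=
| EVar (v : nat)
| EConst (n : nat)
| EOp (o : binop) (e1 e2 : expr)
| ELoad (e : expr).

Inductive prog :=
| PSkip
| PAssign (v : nat) (e : expr)
| PStore (e1 e2 : expr)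
| PSeq (p q : prog)
| PIf (e : expr) (p q : prog)
| PFor (v : nat) (e : expr) (p : prog).

Definition nat_binop (o : binop) (x y : nat) : nat :=
  match o with
  | OpAdd => x + y
  | OpSub => x - y
  | OpMul => x * y
  | OpDiv => x %/ y
  | OpMod => x %% y
  | OpAnd => Nat.land x y
  | OpOr => Nat.lor x y
  | OpXor => Nat.lxor x y
  | OpShl => x * 2 ^ y
  | OpShr => x %/ 2 ^ y
  | OpLt => x < y
  | OpEq => x == y
  end.

(* Source states reuse [state]: the registers hold the program variables. *)
Fixpoint eval (st : state) (e : expr) : nat :=
  match e with
  | EVar v => regs st v
  | EConst n => n
  | EOp o e1 e2 => nat_binop o (eval st e1) (eval st e2)
  | ELoad e => memory st (eval st e)
  end.

(** No subexpression overflows and no subtraction goes below zero, so word arithmetic agrees with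
    arithmetic on naturals. *)
Fixpoint fits (w : nat) (st : state) (e : expr) : Prop :=
  match e with
  | EVar v => regs st v < 2 ^ w
  | EConst n => n < 2 ^ w
  | EOp o e1 e2 => [/\ fits w st e1, fits w st e2,
      nat_binop o (eval st e1) (eval st e2) < 2 ^ w
      & if o is OpSub then eval st e2 <= eval st e1 else True]
  | ELoad e => fits w st e /\ memory st (eval st e) < 2 ^ w
  end.

Lemma fits_lt w st e : fits w st e -> eval st e < 2 ^ w.
Proof. by case: e => //= [o e1 e2 []|e []]. Qed.

Lemma eval_fits w o x y : x < 2 ^ w -> nat_binop o x y < 2 ^ w ->
  (if o is OpSub then y <= x else True) -> eval_binop w o x y = nat_binop o x y.
Proof.
case: o => //= xw b le; rewrite /eval_binop ?(modn_small b) //.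
have [yx|xy] := leqP y (2 ^ w); last by lia.
by rewrite (_ : x + (2 ^ w - y) = x - y + 2 ^ w) ?modnDr ?modn_small //; lia.
Qed.

Fixpoint expr_cost (e : expr) : nat :=
  match e with
  | EVar _ => 2
  | EConst _ => 1
  | EOp _ e1 e2 => expr_cost e1 + expr_cost e2 + 1
  | ELoad e => expr_cost e + 1
  end.

Section Compiler.
Variables (w m : nat).

(* The registers below [m] are left to the LCS program. *)
Definition var (v : nat) := m + v.*2.
Definition tmp (d : nat) := m + d.*2.+1.

(** The machine has no register copy; adding a zero replaces it. *)
Definition move_reg (r r' d : nat) : cmd :=
  CSeq (CConst (tmp d) 0) (COp OpAdd r r' (tmp d)).

Fixpoint compile_expr (d : nat) (e : expr) : cmd :=
  match e with
  | EVar v => move_reg (tmp d) (var v) d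
  | EConst n => CConst (tmp d) n
  | EOp o e1 e2 => CSeq (compile_expr d e1)
      (CSeq (compile_expr d.+1 e2) (COp o (tmp d) (tmp d) (tmp d.+1)))
  | ELoad e => CSeq (compile_expr d e) (CLoad (tmp d) (tmp d))
  end.

(** A loop keeps its bound, counter and test in three temporaries, and its body is compiled above
    them. The counter is only copied into [v], so assignments to [v] do not disturb the loop. *)
Fixpoint compile (d : nat) (p : prog) : cmd :=
  match p with
  | PSkip => CSkip
  | PAssign v e => CSeq (compile_expr d e) (move_reg (var v) (tmp d) d.+1)
  | PStore e1 e2 => CSeq (compile_expr d e1)
      (CSeq (compile_expr d.+1 e2) (CStore (tmp d) (tmp d.+1)))
  | PSeq p q => CSeq (compile d p) (compile d q)
  | PIf e p q => CSeq (compile_expr d e) (CIf (tmp d) (compile d p) (compile d q))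
  | PFor v e p => CSeq (compile_expr d e) (CSeq (CConst (tmp d.+1) 0)
      (CSeq (COp OpLt (tmp d.+2) (tmp d.+1) (tmp d))
      (CWhile (tmp d.+2)
        (CSeq (move_reg (var v) (tmp d.+1) d.+2)
        (CSeq (compile d.+3 p)
        (CSeq (CConst (tmp d.+2) 1)
        (CSeq (COp OpAdd (tmp d.+1) (tmp d.+1) (tmp d.+2))
              (COp OpLt (tmp d.+2) (tmp d.+1) (tmp d)))))))))
  end.

Fixpoint writes (p : prog) : seq nat :=
  match p with
  | PSkip | PStore _ _ => [::]
  | PAssign v _ => [:: v]
  | PSeq p q | PIf _ p q => writes p ++ writes q
  | PFor v _ p => v :: writes p
  end.

Definition sees (s st : state) :=
  (forall v, regs s (var v) = regs st v) /\ memory s = memory st.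

(** The first clause leaves the registers of the LCS program at zero; the second protects pending
    operands and the counters of enclosing loops. *)
Definition keeps (d : nat) (s s' : state) :=
  (forall r, r < m -> regs s' r = regs s r) /\
  (forall j, j < d -> regs s' (tmp j) = regs s (tmp j)).

Lemma keeps_trans d s1 s2 s3 : keeps d s1 s2 -> keeps d s2 s3 -> keeps d s1 s3.
Proof.
by move=> [a b] [a' b']; split=> r rm; [rewrite a' ?a|rewrite b' ?b].
Qed.

Lemma keepsW d d' s s' : d' <= d -> keeps d s s' -> keeps d' s s'.
Proof. by move=> dd [a b]; split=> // j jd; apply: b; apply: leq_trans dd. Qed.

Lemma keeps_tmp d d' s x : d <= d' -> keeps d s (set_reg s (tmp d') x).
Proof.
move=> dd; split=> r rm; rewrite /= /update; case: eqP => //; rewrite /tmp; lia.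
Qed.

Lemma keeps_var d s v x : keeps d s (set_reg s (var v) x).
Proof. by split=> r rm; rewrite /= /update; case: eqP => //; rewrite /tmp /var; lia. Qed.

Lemma keeps_mem d s a x : keeps d s (Defs.set_mem s a x).
Proof. by []. Qed.

Lemma sees_tmp s st d x : sees s st -> sees (set_reg s (tmp d) x) st.
Proof.
move=> [a b]; split=> // v; rewrite /= /update; case: eqP => // e.
by exfalso; move: e; rewrite /tmp /var; lia.
Qed.

Lemma sees_var s st v x : sees s st -> sees (set_reg s (var v) x) (set_reg st v x).
Proof.
move=> [a b]; split=> // v'; rewrite /= /update -a.
by rewrite /var eqn_add2l (can_eq doubleK).
Qed.

Lemma regs_set s r x : regs (set_reg s r x) r = x.
Proof. by rewrite /= /update eqxx. Qed.

Lemma exec_move r r' d s : r' != tmp d -> regs s r' < 2 ^ w ->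
  exec w (move_reg r r' d) s 2
    (set_reg (set_reg s (tmp d) 0) r (regs s r')).
Proof.
move=> nr lt; apply: (@ExecSeq w _ _ _ _ _ 1 1); first by constructor.
rewrite mod0n; set z := set_reg s (tmp d) 0.
suff <- : eval_binop w OpAdd (regs z r') (regs z (tmp d)) = regs s r' by constructor.
by rewrite regs_set /eval_binop addn0 /= /update (negPf nr) modn_small.
Qed.

Lemma var_tmp v d : (var v == tmp d) = false.
Proof. by apply/eqP; rewrite /var /tmp; lia. Qed.

Lemma tmp_eq d d' : (tmp d == tmp d') = (d == d').
Proof. by apply/eqP/eqP => [|->//]; rewrite /tmp; lia. Qed.

Lemma compile_exprP e d s st : sees s st -> fits w st e ->
  exists t s', [/\ exec w (compile_expr d e) s t s', t <= expr_cost e,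
    sees s' st, keeps d s s' & regs s' (tmp d) = eval st e].
Proof.
elim: e d s => [v|n|o e1 IH1 e2 IH2|e IH] d s ss /= f.
- eexists; eexists; split; first by apply: exec_move; rewrite ?var_tmp // (proj1 ss).
  + by [].
  + by do 2!apply: sees_tmp.
  + by apply: (keeps_trans (keeps_tmp _ _ (leqnn d))); apply: keeps_tmp.
  by rewrite regs_set (proj1 ss).
- eexists; eexists; split; first by constructor.
  + by [].
  + exact: sees_tmp.
  + exact: keeps_tmp.
  by rewrite regs_set modn_small.
- case: f => f1 f2 f3 f4.
  have [t1 [s1 [x1 c1 ss1 k1 r1]]] := IH1 d s ss f1.
  have [t2 [s2 [x2 c2 ss2 k2 r2]]] := IH2 d.+1 s1 ss1 f2.
  eexists; eexists; split.
  + by apply: (ExecSeq x1 (ExecSeq x2 (ExecOp _ _ _ _ _ _))).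
  + lia.
  + exact: sees_tmp.
  + apply: keeps_trans k1 (keeps_trans (keepsW (leqnSn d) k2) _); exact: keeps_tmp.
  rewrite regs_set r2 (proj2 k2) ?ltnSn // r1 eval_fits //; exact: fits_lt f1.
- case: f => f1 f2.
  have [t1 [s1 [x1 c1 ss1 k1 r1]]] := IH d s ss f1.
  eexists; eexists; split.
  + by apply: (ExecSeq x1 (ExecLoad _ _ _ _)).
  + lia.
  + exact: sees_tmp.
  + apply: keeps_trans k1 _; exact: keeps_tmp.
  by rewrite regs_set r1 (proj2 ss1).
Qed.

Definition same_off (ws : seq nat) (st st' : state) :=
  forall v, v \notin ws -> regs st' v = regs st v.

(** Total correctness within time [N], with the frame condition on unwritten variables built in.
    Quantifying over [d] makes a specification usable under any nesting of loops. *)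
Definition wp (p : prog) (st : state) (N : nat) (Q : state -> Prop) :=
  forall d s, sees s st -> exists t s' st',
    [/\ exec w (compile d p) s t s', t <= N, sees s' st', keeps d s s' &
      same_off (writes p) st st' /\ Q st'].

Lemma wp_weaken p st N N' (Q Q' : state -> Prop) :
  N <= N' -> (forall st', Q st' -> Q' st') -> wp p st N Q -> wp p st N' Q'.
Proof.
move=> NN QQ h d s /(h d) [t [s' [st' [x c ss k [f q]]]]].
by exists t, s', st'; split=> //; [apply: leq_trans NN|split=> //; apply: QQ].
Qed.

Lemma wp_cost p st N N' Q : N <= N' -> wp p st N Q -> wp p st N' Q.
Proof. by move=> NN; apply: wp_weaken. Qed.

Lemma wp_frame p st N (Q : state -> Prop) :
  wp p st N (fun st' => same_off (writes p) st st' -> Q st') -> wp p st N Q.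
Proof.
move=> h d s /(h d) [t [s' [st' [x c ss k [f q]]]]].
by exists t, s', st'; split=> //; split=> //; apply: q.
Qed.

Lemma wp_skip st (Q : state -> Prop) : Q st -> wp PSkip st 0 Q.
Proof. by move=> q d s ss; exists 0, s, st; split=> //; constructor. Qed.

Lemma same_off_set ws st v x : v \in ws -> same_off ws st (set_reg st v x).
Proof.
by move=> vw u uw; rewrite /= /update; case: eqP => // e; rewrite e vw in uw.
Qed.

Lemma wp_assign v e st (Q : state -> Prop) :
  fits w st e -> Q (set_reg st v (eval st e)) ->
  wp (PAssign v e) st (expr_cost e + 2) Q.
Proof.
move=> fe q d s ss; have [t [s' [x c ss' k r]]] := compile_exprP d ss fe.
exists (t + 2); eexists; exists (set_reg st v (eval st e)); split.
- apply: (ExecSeq x); apply: exec_move; rewrite ?tmp_eq ?r ?fits_lt //.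
  by rewrite neq_ltn ltnSn.
- by rewrite leq_add2r.
- by rewrite r; apply: sees_var; apply: sees_tmp.
- by apply: keeps_trans k (keeps_trans _ (keeps_var _ _ _ _)); apply: keeps_tmp.
by split=> //; apply: same_off_set; rewrite inE.
Qed.

Lemma wp_store e1 e2 st (Q : state -> Prop) :
  fits w st e1 -> fits w st e2 -> Q (Defs.set_mem st (eval st e1) (eval st e2)) ->
  wp (PStore e1 e2) st (expr_cost e1 + expr_cost e2 + 1) Q.
Proof.
move=> f1 f2 q d s ss; have [t1 [s1 [x1 c1 ss1 k1 r1]]] := compile_exprP d ss f1.
have [t2 [s2 [x2 c2 ss2 k2 r2]]] := compile_exprP d.+1 ss1 f2.
eexists; eexists; exists (Defs.set_mem st (eval st e1) (eval st e2)); split.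
- by apply: (ExecSeq x1 (ExecSeq x2 (ExecStore _ _ _ _))).
- lia.
- split; first exact: (proj1 ss2).
  by rewrite /= r2 (proj2 k2) // r1 (proj2 ss2).
- exact: (keeps_trans k1 (keeps_trans (keepsW (leqnSn d) k2) (keeps_mem _ _ _ _))).
by [].
Qed.

Lemma wp_seq p q st N1 N2 Q :
  wp p st N1 (fun st1 => wp q st1 N2 Q) -> wp (PSeq p q) st (N1 + N2) Q.
Proof.
move=> h d s /(h d) [t1 [s1 [st1 [x1 c1 ss1 k1 [f1 h1]]]]].
have [t2 [s2 [st2 [x2 c2 ss2 k2 [f2 qq]]]]] := h1 d _ ss1.
exists (t1 + t2), s2, st2; split=> //.
- exact: ExecSeq x1 x2.
- exact: leq_add.
- exact: keeps_trans k1 k2.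
split=> // v; rewrite /= mem_cat => /norP[v1 v2].
by rewrite f2 ?f1.
Qed.

Lemma wp_if e p q st N Q : fits w st e ->
  (if eval st e != 0 then wp p st N Q else wp q st N Q) ->
  wp (PIf e p q) st (expr_cost e + 1 + N) Q.
Proof.
move=> fe h d s ss; have [t [s' [x c ss' k r]]] := compile_exprP d ss fe.
case: ifP h => [nz|/negbT]; last rewrite negbK => /eqP z.
  move=> /(_ d _ ss') [t1 [s1 [st1 [x1 c1 ss1 k1 [f1 h1]]]]].
  exists (t + t1.+1), s1, st1; split=> //.
  - by apply: (ExecSeq x); apply: ExecIfTrue; rewrite // r.
  - lia.
  - exact: keeps_trans k k1.
  by split=> // v; rewrite /= mem_cat => /norP[v1 v2]; apply: f1.
move=> /(_ d _ ss') [t1 [s1 [st1 [x1 c1 ss1 k1 [f1 h1]]]]].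
exists (t + t1.+1), s1, st1; split=> //.
- by apply: (ExecSeq x); apply: ExecIfFalse; rewrite // r.
- lia.
- exact: keeps_trans k k1.
by split=> // v; rewrite /= mem_cat => /norP[v1 v2]; apply: f1.
Qed.

(** The 6 per round are 2 for copying the counter, 3 for incrementing and comparing, and 1 for the
    loop test. The 3 outside are the initial counter, the first comparison and the last test. *)
Lemma wp_for v e p st n B (I : nat -> state -> Prop) (Q : state -> Prop) :
  fits w st e -> eval st e = n -> I 0 st ->
  (forall i st', i < n -> same_off (v :: writes p) st st' -> I i st' ->
     wp p (set_reg st' v i) B (I i.+1)) ->
  (forall st', same_off (v :: writes p) st st' -> I n st' -> Q st') ->
  wp (PFor v e p) st (expr_cost e + 3 + n * (B + 6)) Q.
Proof.
move=> fe ve i0 step fin d s ss.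
have [t [s1 [x c ss1 k r]]] := compile_exprP d ss fe.
have nw : n < 2 ^ w by rewrite -ve; apply: fits_lt.
pose body := (CSeq (move_reg (var v) (tmp d.+1) d.+2)
        (CSeq (compile d.+3 p)
        (CSeq (CConst (tmp d.+2) 1)
        (CSeq (COp OpAdd (tmp d.+1) (tmp d.+1) (tmp d.+2))
              (COp OpLt (tmp d.+2) (tmp d.+1) (tmp d)))))).
have loop : forall j i z st', i + j = n -> sees z st' ->
  same_off (v :: writes p) st st' -> I i st' ->
  regs z (tmp d) = n -> regs z (tmp d.+1) = i -> regs z (tmp d.+2) = (0 < j) ->
  exists t' z' st'', [/\ exec w (CWhile (tmp d.+2) body) z t' z',
     t' <= 1 + j * (B + 6), sees z' st'', keeps d z z' &
     same_off (v :: writes p) st st'' /\ I n st''].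
  elim=> [|j IHj] i z st' ij sz off ii rn ri rb.
    rewrite addn0 in ij; exists 1, z, st'; split=> //.
      by apply: ExecWhileFalse; rewrite rb.
    by split=> //; rewrite -ij.
  have iw : i < 2 ^ w by lia.
  have w1 : 1 < 2 ^ w by lia.
  pose z1 := set_reg (set_reg z (tmp d.+2) 0) (var v) i.
  have x1 : exec w (move_reg (var v) (tmp d.+1) d.+2) z 2 z1.
    by rewrite /z1 -ri; apply: exec_move; rewrite ?tmp_eq ?ri // neq_ltn ltnSn.
  have sz1 : sees z1 (set_reg st' v i) by apply: sees_var; apply: sees_tmp.
  have i_n : i < n by lia.
  have [t2 [z2 [st2 [x2 c2 sz2 k2 [f2 i2]]]]] := step i st' i_n off ii d.+3 _ sz1.
  have kz1 : keeps d.+2 z z1.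
    by apply: keeps_trans (keeps_tmp _ _ (leqnn _)) (keeps_var _ _ _ _).
  have e0 : regs z2 (tmp d) = n by rewrite (proj2 k2) ?(proj2 kz1) // ltnW.
  have e1 : regs z2 (tmp d.+1) = i by rewrite (proj2 k2) ?(proj2 kz1).
  pose z3 := set_reg z2 (tmp d.+2) 1.
  have x3 : exec w (CConst (tmp d.+2) 1) z2 1 z3.
    by have := ExecConst w z2 (tmp d.+2) 1; rewrite modn_small.
  pose z4 := set_reg z3 (tmp d.+1) i.+1.
  have x4 : exec w (COp OpAdd (tmp d.+1) (tmp d.+1) (tmp d.+2)) z3 1 z4.
    rewrite /z4 (_ : i.+1 = eval_binop w OpAdd (regs z3 (tmp d.+1)) (regs z3 (tmp d.+2))).
      by constructor.
    have -> : regs z3 (tmp d.+1) = i.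
      by rewrite /z3 /= /update tmp_eq ifF ?e1 //; lia.
    by rewrite /z3 regs_set /eval_binop addn1 modn_small //; lia.
  pose z5 := set_reg z4 (tmp d.+2) (0 < j).
  have x5 : exec w (COp OpLt (tmp d.+2) (tmp d.+1) (tmp d)) z4 1 z5.
    rewrite /z5 (_ : (0 < j : nat) = eval_binop w OpLt (regs z4 (tmp d.+1)) (regs z4 (tmp d))).
      by constructor.
    have -> : regs z4 (tmp d) = n.
      by rewrite /z4 /z3 /= /update !tmp_eq !ifF ?e0 //; lia.
    by rewrite /z4 regs_set /eval_binop modn_small; lia.
  have k5 : keeps d z z5.
    apply: keeps_trans (keepsW _ kz1) _; first by lia.
    apply: keeps_trans (keepsW _ k2) _; first by lia.
    apply: (@keeps_trans _ _ z3); first by apply: keeps_tmp; lia.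
    apply: (@keeps_trans _ _ z4); first by apply: keeps_tmp; lia.
    by apply: keeps_tmp; lia.
  have sz5 : sees z5 st2 by do 3!apply: sees_tmp.
  have [||||||t6 [z6 [st6 [x6 c6 sz6 k6 [f6 i6]]]]] := IHj i.+1 z5 st2 _ sz5.
  - by lia.
  - move=> u uw; rewrite f2; last by move: uw; rewrite inE => /norP[].
    rewrite -(off u uw) /= /update; case: eqP => // uv.
    by move: uw; rewrite uv inE eqxx.
  - by [].
  - by rewrite /z5 /z4 /z3 /= /update !tmp_eq !ifF ?e0 //; lia.
  - by rewrite /z5 /z4 /= /update !tmp_eq eqxx ifF //; lia.
  - by rewrite /z5 regs_set.
  exists (2 + (t2 + (1 + (1 + 1))) + t6).+1, z6, st6; split=> //.
  - apply: ExecWhileTrue x6; first by rewrite rb.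
    exact: ExecSeq x1 (ExecSeq x2 (ExecSeq x3 (ExecSeq x4 x5))).
  - by rewrite mulSn; lia.
  - exact: keeps_trans k5 k6.
pose s2 := set_reg s1 (tmp d.+1) 0.
have x2 : exec w (CConst (tmp d.+1) 0) s1 1 s2.
  by have := ExecConst w s1 (tmp d.+1) 0; rewrite mod0n.
pose s3 := set_reg s2 (tmp d.+2) (0 < n).
have r2 : regs s2 (tmp d) = n.
  by rewrite /s2 /= /update tmp_eq ifF ?r //; lia.
have x3 : exec w (COp OpLt (tmp d.+2) (tmp d.+1) (tmp d)) s2 1 s3.
  rewrite /s3 (_ : (0 < n : nat) = eval_binop w OpLt (regs s2 (tmp d.+1)) (regs s2 (tmp d))).
    by constructor.
  by rewrite r2 /s2 regs_set /eval_binop modn_small //; lia.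
have k3 : keeps d s s3.
  apply: keeps_trans k _; apply: (@keeps_trans _ _ s2); apply: keeps_tmp; lia.
have [|||||||t4 [s4 [st4 [x4 c4 ss4 k4 [f4 i4]]]]] := loop n 0 s3 st.
- by [].
- by do 2!apply: sees_tmp.
- by [].
- by [].
- by rewrite /s3 /= /update tmp_eq ifF ?r2 //; lia.
- by rewrite /s3 /s2 /= /update !tmp_eq eqxx ifF //; lia.
- by rewrite /s3 regs_set.
exists (t + (1 + (1 + t4))), s4, st4; split.
- exact: ExecSeq x (ExecSeq x2 (ExecSeq x3 x4)).
- lia.
- by [].
- exact: keeps_trans k3 k4.
by split=> //; apply: fin.
Qed.

End Compiler.

Lemma wp_if2 w m e p q st N1 N2 (Q : state -> Prop) : fits w st e ->
  (eval st e != 0 -> wp w m p st N1 Q) -> (eval st e = 0 -> wp w m q st N2 Q) ->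
  wp w m (PIf e p q) st (expr_cost e + 1 + (N1 + N2)) Q.
Proof.
move=> fe hp hq; apply: wp_if => //; case: ifP => [nz|/eqP z].
  by apply: wp_cost (hp nz); apply: leq_addr.
by apply: wp_cost (hq z); apply: leq_addl.
Qed.

Ltac fit := repeat match goal with
  | |- and4 _ _ _ _ => split | |- and _ _ => split | |- True => exact I end.

Lemma wp_assign_to w m v e x q st N2 (Q : state -> Prop) : fits w st e ->
  eval st e = x -> wp w m q (set_reg st v x) N2 Q ->
  wp w m (PSeq (PAssign v e) q) st (expr_cost e + 2 + N2) Q.
Proof. by move=> fe <- hq; apply: wp_seq; apply: wp_assign. Qed.

(** * The reduction as a program *)

Section Decode.
Variables (W : nat) (leaf : nat -> nat -> nat -> nat -> nat) (z : bool).

(** Reads [r] in base 2W from the leading digit. Digit parity chooses the half, and the rest of the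
    digit is a place in the list, which [mid] turns into a node. Being tail recursive, it becomes a
    loop. *)
Fixpoint decode (k i u v q r : nat) : nat :=
  if k is k'.+1 then
    let dg := r %/ W.*2 ^ k' in
    let m := mid W z (dg %/ 2) in
    if dg %% 2 != 0 then
      decode k' i.*2.+1 m v (q * W.*2 + m.*2.+1) (r %% W.*2 ^ k')
    else decode k' i.*2 u m (q * W.*2 + m.*2) (r %% W.*2 ^ k')
  else leaf i u v q.

Lemma map_iota_mul (S : Type) (f : nat -> S) a b :
  [seq f r | r <- iota 0 (a * b)] =
  flatten [seq [seq f (d * b + r) | r <- iota 0 b] | d <- iota 0 a].
Proof.
elim: a => // a IHa.
rewrite mulSnr iotaD map_cat IHa -(addn1 a) iotaD map_cat flatten_cat /= cats0.
by congr (_ ++ _); rewrite !add0n -[X in iota X](addn0 (a * b)) iotaDl -map_comp.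
Qed.

Lemma flatten_double (S : Type) (F : nat -> seq S) a :
  flatten [seq F d | d <- iota 0 a.*2] =
  flatten [seq F d.*2 ++ F d.*2.+1 | d <- iota 0 a].
Proof.
elim: a => // a IHa; rewrite doubleS -addn2 -(addn1 a) !iotaD !map_cat !flatten_cat.
by rewrite IHa /= !add0n !cats0.
Qed.

(** Cutting the range of positions by leading digit, and pairing even digits with the following odd
    ones, reproduces the concatenation in [leaves]. *)
Lemma decode_leaves k i u v q :
  [seq decode k i u v q r | r <- iota 0 (W.*2 ^ k)] = leaves W leaf z k i u v q.
Proof.
elim: k i u v q => [|k IHk] i u v q //=.
rewrite expnS map_iota_mul flatten_double -map_comp; congr flatten.
apply: eq_map => d /=; rewrite -!IHk; congr (_ ++ _); apply/eq_in_map => r;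
  rewrite mem_iota => /= rX;
  have X0 : 0 < W.*2 ^ k by lia.
- rewrite divnMDl // divn_small // addn0 modnMDl (modn_small rX).
  by rewrite modn2 odd_double divn2 doubleK.
- rewrite divnMDl // divn_small // addn0 modnMDl (modn_small rX).
  by rewrite modn2 divn2 /= odd_double uphalf_double.
Qed.
End Decode.

Local Notation "$ v" := (EVar v) (at level 1, format "$ v").
Local Notation "# n" := (EConst n) (at level 1, format "# n").
Local Notation "a [+] b" := (EOp OpAdd a b) (at level 50, left associativity).
Local Notation "a [-] b" := (EOp OpSub a b) (at level 50, left associativity).
Local Notation "a [*] b" := (EOp OpMul a b) (at level 40, left associativity).
Local Notation "a [/] b" := (EOp OpDiv a b) (at level 40, left associativity).
Local Notation "a [%] b" := (EOp OpMod a b) (at level 40, left associativity).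
Local Notation "a [<<] b" := (EOp OpShl a b) (at level 50, left associativity).
Local Notation "a [>>] b" := (EOp OpShr a b) (at level 50, left associativity).
Local Notation "a [<] b" := (EOp OpLt a b) (at level 70, no associativity).
Local Notation "a [==] b" := (EOp OpEq a b) (at level 70, no associativity).
Local Notation "v <~ e" := (PAssign v e) (at level 75, no associativity).
Local Notation "p ;; q" := (PSeq p q) (at level 80, right associativity).

(* Variables: 0 n, 1 T, 2 W, 3 T-1, 4 h, 5 2^h, 6 2^k, 7 k, 8 (2W)^k, 9 K, 10 N,
   11 threshold, 12 input size, 13 address of the output, 14 2^h K, 20 output
   pointer, 21 assignment, 22 position of the leaf, 23 level, 24 to 27 q i u v,
   28 rest of the position, 29 block size, 30 digit, 31 half, 32 middle node,
   33 label, 34 edge test, 35 symbol, 36 and 37 counters. *)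
Definition symbol_level (z : bool) : prog :=
  29 <~ $29 [/] ($2 [+] $2) ;;
  30 <~ $28 [/] $29 ;;
  28 <~ $28 [%] $29 ;;
  31 <~ $30 [%] #2 ;;
  32 <~ (if z then $2 [-] #1 [-] $30 [/] #2 else $30 [/] #2) ;;
  24 <~ $24 [*] ($2 [+] $2) [+] ($32 [+] $32 [+] $31) ;;
  25 <~ $25 [+] $25 [+] $31 ;;
  PIf $31 (26 <~ $32) (27 <~ $32).

Definition symbol_leaf (z : bool) : prog :=
  PIf ($25 [<] $3)
    (33 <~ ELoad (#3 [+] $25) ;;
     PIf (($33 [<] $4) [==] #(z : nat))
       (34 <~ #1)
       (34 <~ ELoad (#3 [+] $3 [+] #2 [*] (($25 [*] $2 [+] $26) [*] $2 [+] $27) [+]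
          (($21 [>>] ($33 [-] (if z then $4 else #0))) [%] #2))))
    (34 <~ ($26 [==] $27)) ;;
  PIf $34 (35 <~ $24 [+] #4) (35 <~ #(2 + z)).

Definition symbol (z : bool) : prog :=
  24 <~ #0 ;; 25 <~ #0 ;; 26 <~ #0 ;; 27 <~ #0 ;; 28 <~ $22 ;; 29 <~ $8 ;;
  PFor 23 $7 (symbol_level z) ;;
  symbol_leaf z.

Definition emit (e : expr) : prog := PStore $20 e ;; 20 <~ $20 [+] #1.

Definition side (z : bool) : prog :=
  PFor 36 $14 (emit #(~~ z : nat)) ;;
  PFor 21 $5
    (PFor 22 $8 (symbol z ;; emit $35) ;;
     PFor 36 $9 (emit #(z : nat)) ;;
     PFor 36 $9 (emit #(~~ z : nat))) ;;
  PFor 36 $14 (emit #(~~ z : nat)).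

(** With Z = sz + 2N + 1 the source and target ranges are disjoint. All Z cells are moved, so the
    zeros above the instance erase what is left of the input. *)
Definition copy_down : prog :=
  PFor 37 $13
    (PStore $37 (ELoad ($13 [+] $37)) ;; PStore ($13 [+] $37) #0).

Definition read_header : prog :=
  0 <~ ELoad #0 ;; 1 <~ ELoad #1 ;; 2 <~ ELoad #2 ;; 3 <~ $1 [-] #1.

(** The powers 2^j and (2W)^j grow together until 2^j reaches T, which replaces a logarithm. T
    rounds are enough because k is at most T. *)
Definition parameters : prog :=
  4 <~ ($0 [+] #1) [/] #2 ;;
  5 <~ #1 [<<] $4 ;;
  6 <~ #1 ;; 7 <~ #0 ;; 8 <~ #1 ;;
  PFor 23 $1
    (PIf ($6 [<] $1)
      (6 <~ $6 [+] $6 ;; 7 <~ $7 [+] #1 ;; 8 <~ $8 [*] ($2 [+] $2))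
      PSkip) ;;
  9 <~ $6 [-] #1 ;;
  14 <~ $5 [*] $9 ;;
  10 <~ $5 [*] ($8 [+] #4 [*] $9) ;;
  11 <~ #2 [*] $14 ;;
  12 <~ #3 [+] $3 [+] #2 [*] ($3 [*] $2 [*] $2) ;;
  13 <~ $12 [+] #2 [*] $10 [+] #1 ;;
  20 <~ $13.

Definition reduction : prog :=
  parameters ;; emit $10 ;; side false ;; side true ;; copy_down.

Definition overlay (f : nat -> nat) (Z : nat) (l : seq nat) : nat -> nat :=
  fun a => if Z <= a < Z + size l then nth 0 l (a - Z) else f a.

Lemma overlay_rcons f Z l x :
  update (overlay f Z l) (Z + size l) x = overlay f Z (rcons l x).
Proof.
apply/funext => a; rewrite /update /overlay size_rcons nth_rcons.
case: eqP => [->|ne]; first by rewrite addKn ltnn eqxx ifT //; lia.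
by case: ifP => h1; [rewrite !ifT //|rewrite ifF //]; lia.
Qed.

Lemma mid_lt W z d : d < W -> mid W z d < W.
Proof. by rewrite /mid; case: z; lia. Qed.

Lemma symbol_level_arith W X rr z : 0 < X -> rr < W.*2 * X ->
  let dg := rr %/ X in let md := mid W z (dg %/ 2) in
  [/\ dg < W.*2, md < W, dg <= rr, rr %% X < X & (W.*2 * X) %/ (W + W) = X].
Proof.
move=> X0 rX; have dW : rr %/ X < W.*2 by rewrite ltn_divLR.
have W0 : 0 < W.*2 by case: (W) rX.
split=> //; first by apply: mid_lt; rewrite ltn_divLR // muln2.
- exact: leq_div.
- by rewrite ltn_mod.
by rewrite addnn mulKn.
Qed.

Lemma wp_symbol_level w m z st W X q i u v rr B (Q : state -> Prop) :
  regs st 2 = W -> regs st 24 = q -> regs st 25 = i -> regs st 26 = u ->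
  regs st 27 = v -> regs st 28 = rr -> regs st 29 = W.*2 * X ->
  0 < X -> rr < W.*2 * X -> u < W -> v < W ->
  W.*2 * X <= B -> q * W.*2 + W.*2 <= B -> i.*2 + 2 <= B -> B + 4 < 2 ^ w ->
  (forall st', memory st' = memory st -> regs st' 29 = X -> regs st' 28 = rr %% X ->
    regs st' 24 = q * W.*2 + ((mid W z (rr %/ X %/ 2)).*2 + rr %/ X %% 2) ->
    regs st' 25 = i.*2 + rr %/ X %% 2 ->
    regs st' 26 = (if rr %/ X %% 2 != 0 then mid W z (rr %/ X %/ 2) else u) ->
    regs st' 27 = (if rr %/ X %% 2 != 0 then v else mid W z (rr %/ X %/ 2)) ->
    Q st') ->
  wp w m (symbol_level z) st 120 Q.
Proof.
move=> e2 e24 e25 e26 e27 e28 e29 X0 rX uW vW XB qB iB Bw.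
have [] := symbol_level_arith z X0 rX.
set dg := rr %/ X; set md := mid W z (dg %/ 2) => dW mW dr rrX WX q'.
have [rm erm] : exists rm, rr %% X = rm by exists (rr %% X).
rewrite erm in rrX q'.
have b1 : q * (W + W) = q * W.*2 by rewrite addnn.
have b2 : q * W.*2 <= B by lia.
have b8 : q <= q * W.*2 by rewrite leq_pmulr // double_gt0; lia.
move: (q * W.*2) b1 b2 b8 qB q' => qW b1 b2 b8 qB q'.
have b3 : dg %% 2 < 2 by rewrite ltn_mod.
have b4 : dg %/ 2 <= dg by apply: leq_div.
have b5 : 0 < W by lia.
have b6 : dg %/ 2 < W by rewrite ltn_divLR // muln2.
have emd : md = if z then W - 1 - dg %/ 2 else dg %/ 2.
  by rewrite /md /mid; case: (z); rewrite // subn1.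
have b7 : X <= W.*2 * X by rewrite leq_pmull // double_gt0.
move: (W.*2 * X) b7 e29 rX XB WX => WX2 b7 e29 rX XB WX.
apply: wp_cost; last first.
  have regsE := (e2, e24, e25, e26, e27, e28, e29).
  apply: (wp_assign_to (x := X)); rewrite /= ?regsE.
  - by fit; lia.
  - by [].
  apply: (wp_assign_to (x := dg)); rewrite /= /update /= ?regsE.
  - by rewrite -/dg; fit; lia.
  - by [].
  apply: (wp_assign_to (x := rm)); rewrite /= /update /= ?regsE.
  - by rewrite erm; fit; lia.
  - by [].
  apply: (wp_assign_to (x := dg %% 2)); rewrite /= /update /= ?regsE.
  - by fit; lia.
  - by [].
  apply: (wp_assign_to (x := md)).
  - by clear emd; case: (z); rewrite /= /update /= ?regsE; fit; lia.
  - by rewrite emd; case: (z); rewrite /= /update /= ?regsE.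
  move: (dg %% 2) b3 q' => s b3 q'.
  apply: (wp_assign_to (x := qW + (md.*2 + s))); rewrite /= /update /= ?regsE ?b1.
  - by fit; lia.
  - by lia.
  apply: (wp_assign_to (x := i.*2 + s)); rewrite /= /update /= ?regsE.
  - by fit; lia.
  - by lia.
  apply: wp_if2; first by rewrite /= /update /=; lia.
    rewrite /= /update /= => s0; apply: wp_assign; rewrite /= /update /=; first lia.
    by apply: q'; rewrite /= /update /= ?regsE ?s0.
  rewrite /= /update /= => s0; apply: wp_assign; rewrite /= /update /=; first lia.
  by apply: q'; rewrite /= /update /= ?regsE ?s0.
by case: (z).
Qed.

(** Bounds every intermediate value of the address computation, as [fits] demands. *)
Lemma edge_cell_lt E W i u v (b : nat) : i < E -> u < W -> v < W -> b < 2 ->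
  [/\ i * W <= E * W * W, i * W + u <= E * W * W, (i * W + u) * W <= E * W * W &
      2 * ((i * W + u) * W + v) + b < 2 * (E * W * W)].
Proof.
move=> iE uW vW b2.
have h1 : i * W + u < E * W.
  by apply: (@leq_trans (i.+1 * W)); rewrite ?leq_mul2r ?iE ?orbT // mulSn; lia.
have h2 : (i * W + u) * W + v < E * W * W.
  apply: (@leq_trans ((i * W + u).+1 * W)); rewrite ?leq_mul2r ?h1 ?orbT // mulSn.
  lia.
have h3 : E * W <= E * W * W by rewrite leq_pmulr //; lia.
by split; lia.
Qed.

Lemma wp_symbol_leaf w m z st mem0 T E W h a q i u v : T.-1 = E ->
  regs st 2 = W -> regs st 3 = E -> regs st 4 = h -> regs st 21 = a ->
  regs st 24 = q -> regs st 25 = i -> regs st 26 = u -> regs st 27 = v ->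
  u < W -> v < W -> q + 4 < 2 ^ w -> i < 2 ^ w -> a < 2 ^ w -> h < 2 ^ w ->
  3 + E + 2 * (E * W * W) + W + 3 < 2 ^ w ->
  (forall c, c < 3 + E + 2 * (E * W * W) -> memory st c = mem0 c) ->
  (forall c, mem0 c < 2 ^ w) ->
  wp w m (symbol_leaf z) st 120 (fun st' => memory st' = memory st /\
    regs st' 35 = leaf_symbol (present mem0 T W h z a) z i u v q).
Proof.
move=> eE e2 e3 e4 e21 e24 e25 e26 e27 uW vW qw iw aw hw szw ememo mw.
have regsE := (e2, e3, e4, e21, e24, e25, e26, e27).
have boolw (b : bool) : (b : nat) < 2 ^ w by case: b; lia.
have eqb_nat (b c : bool) : ((b : nat) == c) = (b == c) by case: b; case: c.
pose pr := present mem0 T W h z a i u v.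
apply: wp_cost; last first.
  apply: wp_seq.
  apply: (@wp_weaken _ _ _ _ _ _ (fun st' => [/\ memory st' = memory st,
    (regs st' 34 != 0) = pr, regs st' 34 < 2 ^ w & regs st' 24 = q]) _ (leqnn _)).
    move=> st' [em e34 w34 e24'].
    apply: wp_if2; first by [].
      rewrite /= e34 => prz; apply: wp_assign; rewrite /= e24'; first by fit; lia.
      by rewrite /leaf_symbol -/pr prz.
    move=> /= r34; apply: wp_assign; rewrite /=; first by case: (z); lia.
    by rewrite /leaf_symbol -/pr -e34 r34.
  apply: wp_if2; rewrite /= ?e3 ?e25.
  - by fit; rewrite ?boolw //; lia.
  - move=> iT0; have iT : i < E by case: (i < _) iT0.
    have c3 : 3 + i < 3 + E + 2 * (E * W * W) by lia.
    apply: wp_seq; apply: wp_assign.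
      by rewrite /= e25 ememo //; fit; rewrite ?mw //; lia.
    rewrite /= e25 ememo //; have xw := mw (3 + i).
    have := erefl pr; rewrite {2}/pr /present eE iT.
    move: (mem0 (3 + i)) xw => x xw epr.
    apply: wp_if2; rewrite /= /update /= ?e4.
    + by fit; rewrite ?boolw.
    + move=> xz; apply: wp_assign; rewrite /= /update /=; first lia.
      split; rewrite ?epr //; last lia.
      by case: ifP => // xz'; move: xz; rewrite eqb_nat xz'.
    move=> xz; have xz' : ((x < h) == z) = false.
      by rewrite -eqb_nat; case: (_ == _) xz.
    rewrite xz' in epr.
    (* The label lies in the half of [z], so the subtraction yielding the bit index does not go
       below zero. *)
    have hx : (if z then h else 0) <= x by move: xz'; case: (z); case: ltnP.
    have fz : fits w (set_reg st 33 x) (if z then EVar 4 else EConst 0).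
      by case: (z); rewrite /= /update /= ?e4 ?expn_gt0.
    have vz : eval (set_reg st 33 x) (if z then EVar 4 else EConst 0) = if z then h else 0.
      by case: (z); rewrite /= /update /= ?e4.
    move: (if z then h else 0) hx epr vz => hz hx epr vz.
    have al : a %/ 2 ^ (x - hz) <= a by apply: leq_div.
    have bw : (a %/ 2 ^ (x - hz)) %% 2 < 2 by rewrite ltn_mod.
    have [bt ebt] : exists bt, (a %/ 2 ^ (x - hz)) %% 2 = bt by eexists.
    have [sh esh] : exists sh, a %/ 2 ^ (x - hz) = sh by eexists.
    rewrite ebt in epr bw; rewrite esh in ebt al.
    have [b1 b2 b3 b4] := edge_cell_lt iT uW vW bw.
    have cl : 3 + E + 2 * ((i * W + u) * W + v) + bt < 3 + E + 2 * (E * W * W) by lia.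
    clear xz xz' boolw eqb_nat.
    apply: wp_assign.
      rewrite /= /update /= ?regsE vz esh ebt; fit; rewrite ?ememo //;
        try exact: mw; clear ebt esh; lia.
    rewrite /= /update /= ?regsE vz esh ebt ememo //; split; rewrite ?mw //.
    by rewrite epr /edge_cell eE.
  - move=> iT0; have iT : (i < E) = false by case: (i < _) iT0.
    apply: wp_assign; rewrite /= ?regsE; first by fit; rewrite ?boolw //; lia.
    rewrite /update /= e24; split; rewrite ?boolw //.
    by rewrite /pr /present eE iT; case: (u == v).
by case: (z).
Qed.

(** Quantities are variables tied by equations, so that linear arithmetic can treat the exponentials
    as atoms. *)
Record params (n T W E h P L k ell K N sz Z : nat) : Prop := Params {
  pT : 1 < T;
  pW : 0 < W;
  pE : T.-1 = E;
  ph : h = n.+1 %/ 2;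
  pP : P = 2 ^ h;
  pk : k = up_log 2 T;
  pL : L = 2 ^ k;
  pell : ell = W.*2 ^ k;
  pK : K = L.-1;
  pN : N = P * (ell + 4 * K);
  psz : sz = 3 + E + 2 * (E * W * W);
  pZ : Z = sz + 2 * N + 1 }.

Lemma params_bounds n T W E h P L k ell K N sz Z :
  params n T W E h P L k ell K N sz Z ->
  [/\ [/\ 0 < P, 0 < k, 0 < ell, L <= ell & P <= N],
      [/\ ell <= N, k < L, h < P, n <= 2 * P & T <= L],
      [/\ W.*2 <= ell, 4 * (P * K) <= N, P * K + P * (ell + 2 * K) + P * K = N,
          1 < L & L = K.+1] &
      [/\ sz <= Z, Z = sz + 2 * N + 1, W <= N, E <= N & h <= N]].
Proof.
case=> T1 W0 eE eh eP ek eL eell eK eN esz eZ.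
have P0 : 0 < P by rewrite eP expn_gt0.
have k0 : 0 < k by rewrite ek up_log_gt0.
have ell0 : 0 < ell by rewrite eell expn_gt0 double_gt0 W0.
have Lell : L <= ell.
  by rewrite eL eell leq_exp2r // -muln2 -[X in X <= _]mul1n leq_mul.
have ellN : ell + 4 * K <= N by rewrite eN leq_pmull.
have PN : P <= N by rewrite eN leq_pmulr //; lia.
have kL : k < L by rewrite eL ltn_expl.
have hP : h < P by rewrite eP ltn_expl.
have nP : n <= 2 * P by move: hP; rewrite eh; clear; lia.
have TL : T <= L by rewrite eL ek up_logP.
have W2ell : W.*2 <= ell.
  by rewrite eell -[X in X <= _]expn1 leq_pexp2l // double_gt0.
have PKN : P * K + P * (ell + 2 * K) + P * K = N by rewrite eN; nia.
have PK : 4 * (P * K) <= N by move: PKN; rewrite !mulnDr; lia.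
by do !split=> //; lia.
Qed.

(** * Correctness and cost of the compiled reduction *)

Section Verification.
Variables (w m : nat) (mem0 : nat -> nat).
Variables (n T W E h P L k ell K N sz Z : nat).
Hypothesis prm : params n T W E h P L k ell K N sz Z.
Hypothesis mem_w : forall a, mem0 a < 2 ^ w.
Hypothesis mem_sz : forall a, sz <= a -> mem0 a = 0.
Hypothesis Zw : 2 * Z + 10 < 2 ^ w.

Definition globals := [:: n; T; W; E; h; P; L; k; ell; K; N; 2 * (P * K); sz; Z; P * K].
Definition glob (st : state) :=
  forall v, v < 15 -> regs st v = nth 0 globals v.

Lemma glob_off ws st st' : all (leq 20) ws -> same_off ws st st' -> glob st ->
  glob st'.
Proof.
move=> /allP a o g v v15; rewrite o ?g //; apply/negP => /a.
by rewrite leqNgt (leq_trans v15).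
Qed.

Lemma glob_set st v x : 20 <= v -> glob st -> glob (set_reg st v x).
Proof.
by move=> v20 g u u20; rewrite /= /update; case: eqP => [e|_]; rewrite ?g //; lia.
Qed.

Ltac facts := case: (params_bounds prm);
  case=> ? ? ? ? ?; case=> ? ? ? ? ?; case=> ? ? ? ? ?; case=> ? ? ? ? ?.

Lemma wp_emit e l st x B : fits w st e -> eval st e = x ->
  expr_cost e <= B ->
  memory st = overlay mem0 Z l -> regs st 20 = Z + size l ->
  size l <= 2 * N ->
  wp w m (emit e) st (B + 9) (fun st' =>
    memory st' = overlay mem0 Z (rcons l x) /\ regs st' 20 = Z + (size l).+1).
Proof.
move=> fe ve eB ml pl sl; facts.
have Zlt : Z + size l + 1 < 2 ^ w by lia.
apply: (@wp_cost _ _ _ _ (2 + expr_cost e + 1 + (2 + 1 + 1 + 2))); first by lia.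
apply: wp_seq; apply: wp_store => //=; first by rewrite pl; lia.
apply: wp_assign => /=; first by rewrite pl; split=> //; lia.
by rewrite pl ml ve overlay_rcons /update /=; split=> //; lia.
Qed.

Lemma wp_fill e l st x c : eval st e = c -> fits w st e -> x < 2 ^ w ->
  memory st = overlay mem0 Z l -> regs st 20 = Z + size l ->
  size l + c <= 2 * N + 1 ->
  wp w m (PFor 36 e (emit (EConst x))) st (expr_cost e + 3 + c * 16) (fun st' =>
    memory st' = overlay mem0 Z (l ++ nseq c x) /\
    regs st' 20 = Z + size (l ++ nseq c x)).
Proof.
move=> ve fe xw ml pl sl.
apply: (wp_for (B := 10) (I := fun i st' => memory st' = overlay mem0 Z (l ++ nseq i x) /\
    regs st' 20 = Z + size (l ++ nseq i x)) fe ve).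
- by rewrite cats0.
- move=> i st' ic _ [mi pi].
  apply: wp_weaken (wp_emit (B := 1) (e := EConst x) (l := l ++ nseq i x) _ _ _ _ _ _) => //=.
  + have -> : x :: nseq i x = nseq i x ++ [:: x].
      by rewrite -[LHS]/(nseq i.+1 x) -addn1 nseqD.
    by move=> st2 [-> ->]; rewrite -cats1 -catA !size_cat /=; split=> //; lia.
  + by rewrite size_cat size_nseq; lia.
- by [].
Qed.

Let leaf z a := leaf_symbol (present mem0 T W h z a) z.

(** After [t] levels, decoding the rest of the position from the current subformula still gives the
    wanted symbol; the bounds keep all values within a word. *)
Definition level_inv (z : bool) (a r : nat) (mm : nat -> nat) (t : nat) (st : state) : Prop :=
  [/\ memory st = mm, regs st 29 = W.*2 ^ (k - t),
      [/\ regs st 24 < W.*2 ^ t, regs st 25 < 2 ^ t, regs st 26 < W,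
          regs st 27 < W & regs st 28 < W.*2 ^ (k - t)] &
      decode W (leaf z a) z (k - t) (regs st 25) (regs st 26) (regs st 27)
             (regs st 24) (regs st 28) = decode W (leaf z a) z k 0 0 0 0 r].

Lemma level_step z a r mm t st : t < k -> glob st -> level_inv z a r mm t st ->
  wp w m (symbol_level z) st 120 (level_inv z a r mm t.+1).
Proof.
move=> tk g [emm e29 [b24 b25 b26 b27 b28] edec]; facts.
have W0 := pW prm; have W20 : 0 < W.*2 by rewrite double_gt0.
have ekt : k - t = (k - t.+1).+1 by rewrite subnSK.
rewrite ekt expnS in e29 b28; rewrite ekt [LHS]/= in edec.
set X := W.*2 ^ (k - t.+1) in e29 b28 edec.
have X0 : 0 < X by rewrite expn_gt0 W20.
have X_ell : W.*2 * X <= ell.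
  by rewrite -expnS -ekt (pell prm) leq_pexp2l // leq_subr.
have t_ell : W.*2 ^ t * W.*2 <= ell by rewrite -expnSr (pell prm) leq_pexp2l.
have t_L : 2 ^ t * 2 <= L by rewrite -expnSr (pL prm) leq_exp2l.
have g2 : regs st 2 = W by rewrite g.
have qt : (regs st 24).+1 * W.*2 <= W.*2 ^ t * W.*2 by rewrite leq_mul2r b24 orbT.
apply: (wp_symbol_level (B := Z) g2 erefl erefl erefl erefl erefl e29) => //.
- lia.
- by move: qt; rewrite mulSn; lia.
- lia.
- lia.
have [] := symbol_level_arith z X0 b28.
move: (regs st 28 %/ X) edec => dg edec dgW mdW _ rX _.
have sb : dg %% 2 < 2 by rewrite ltn_mod.
move: (mid W z (dg %/ 2)) mdW edec => md mdW edec.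
move=> st' em e29' e28' e24' e25' e26' e27'.
split; rewrite -/X; first by rewrite em.
- exact: e29'.
- rewrite e24' e25' e26' e27' e28'; split=> //.
  + by rewrite expnSr; apply: leq_trans qt; rewrite mulSn; lia.
  + by rewrite expnSr; lia.
  + by case: ifP.
  + by case: ifP.
rewrite -edec e24' e25' e26' e27' e28'; case: ifP sb => [s1 sb|/negbFE/eqP -> _].
  by rewrite (_ : dg %% 2 = 1) ?addn1 //; lia.
by rewrite !addn0.
Qed.

Lemma decode_gadget z a r : r < ell ->
  decode W (leaf z a) z k 0 0 0 0 r = nth 0 (gadget mem0 T W h z a) r.
Proof.
move=> rell; rewrite /gadget -(pk prm) -decode_leaves (nth_map 0).
  by rewrite nth_iota -?(pell prm) // add0n.
by rewrite size_iota -(pell prm).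
Qed.

Lemma wp_symbol z a r st : glob st -> regs st 21 = a -> regs st 22 = r ->
  a < P -> r < ell -> (forall c, c < sz -> memory st c = mem0 c) ->
  wp w m (symbol z) st (150 + k * 126) (fun st' =>
    memory st' = memory st /\ regs st' 35 = nth 0 (gadget mem0 T W h z a) r).
Proof.
move=> g ea er aP rell mm; facts.
have W0 := pW prm; have szE := psz prm.
apply: (@wp_cost _ _ _ _
  (3 + (3 + (3 + (3 + (4 + (4 + (2 + 3 + k * (120 + 6) + 120))))))));
  first by lia.
do 4![apply: (wp_assign_to (x := 0)) => //=; first by lia].
apply: (wp_assign_to (x := r)); rewrite /= /update /= ?er //; first by lia.
apply: (wp_assign_to (x := ell)); rewrite /= /update /= ?(g 8) //=; first by lia.
set st0 := set_reg _ 29 ell.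
have g0 : glob st0 by do !apply: glob_set.
have m0 : memory st0 = memory st by [].
have a0 : regs st0 21 = a by rewrite -ea.
have inv0 : level_inv z a r (memory st) 0 st0.
  rewrite /level_inv subn0 expn0 -(pell prm) /= /update /=.
  by split.
move: st0 g0 m0 a0 inv0 => st0 g0 m0 a0 inv0.
apply: wp_seq; apply: (wp_for (B := 120) (n := k) (I := level_inv z a r (memory st))).
- by rewrite /= g0 //=; lia.
- by rewrite /= g0.
- exact: inv0.
- move=> t st1 tk off inv1; apply: level_step => //.
  by apply: glob_set => //; apply: glob_off off g0; case: (z).
move=> st1 off [em e29]; rewrite subnn expn0 /= => [[b24 b25 b26 b27 b28]] edec.
have g1 : glob st1 by apply: glob_off off g0; case: (z).
have a1 : regs st1 21 = a by rewrite off //; case: (z).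
have hw : h < 2 ^ w by lia.
apply: wp_weaken (@wp_symbol_leaf w m z st1 mem0 T E W h a _ _ _ _ (pE prm) _ _ _
  a1 erefl erefl erefl erefl _ _ _ _ _ _ _ _ mem_w) => //.
- by move=> st' [-> ->]; rewrite em; split=> //; rewrite -decode_gadget.
- by rewrite g1.
- by rewrite g1.
- by rewrite g1.
- by move: b24; rewrite -(pell prm); lia.
- by move: b25; rewrite -(pL prm); lia.
- lia.
- lia.
- by move=> c; rewrite -szE => csz; rewrite em mm.
Qed.

Lemma overlay_input l c : c < sz -> overlay mem0 Z l c = mem0 c.
Proof. by move=> csz; facts; rewrite /overlay ifF //; lia. Qed.

Lemma wp_gadget z a l st : glob st -> regs st 21 = a -> a < P ->
  memory st = overlay mem0 Z l -> regs st 20 = Z + size l ->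
  size l + ell <= 2 * N + 1 ->
  wp w m (PFor 22 (EVar 8) (PSeq (symbol z) (emit (EVar 35)))) st
    (5 + ell * (167 + k * 126)) (fun st' =>
    memory st' = overlay mem0 Z (l ++ gadget mem0 T W h z a) /\
    regs st' 20 = Z + size (l ++ gadget mem0 T W h z a)).
Proof.
move=> g ea aP ml pl sl; facts.
have sg : size (gadget mem0 T W h z a) = ell by rewrite size_gadget -(pk prm) -(pell prm).
set G := gadget mem0 T W h z a in sg *.
apply: (@wp_cost _ _ _ _ (2 + 3 + ell * (150 + k * 126 + (2 + 9) + 6))); first by lia.
apply: (wp_for (n := ell) (I := fun r st' => memory st' = overlay mem0 Z (l ++ take r G) /\
    regs st' 20 = Z + size (l ++ take r G))).
- by rewrite /= g //=; lia.
- by rewrite /= g.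
- by rewrite take0 cats0.
- move=> r st1 rell off [m1 p1]; apply: wp_seq; apply: wp_frame.
  have g1 : glob (set_reg st1 22 r).
    by apply: glob_set => //; apply: glob_off off g; case: (z).
  have a1 : regs (set_reg st1 22 r) 21 = a.
    by rewrite /= /update /= -ea off //; case: (z).
  apply: wp_weaken (wp_symbol z g1 a1 _ aP rell _) => //=.
  + move=> st2 [m2 e35] off2.
    have G35 : nth 0 G r < 2 ^ w.
      have rG : nth 0 G r \in G by rewrite mem_nth // sg.
      have := leaves_range rG; rewrite -(pk prm) mul0n mul1n -(pell prm).
      by case: (z) => /= - [|]; lia.
    apply: wp_weaken (wp_emit (e := EVar 35) (l := l ++ take r G) _ e35 _ _ _ _) => //=.
    * move=> st3 [-> ->]; rewrite rcons_cat -take_nth ?sg //.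
      by rewrite !size_cat !size_takel ?sg // ?(ltnW rell) //; split=> //; lia.
    * by rewrite e35.
    * by rewrite m2.
    * by rewrite off2 //; case: (z).
    * by rewrite size_cat size_takel ?sg ?(ltnW rell) //; lia.
  + by rewrite m1 => c; apply: overlay_input.
move=> st1 off [m1 p1]; move: m1 p1.
by rewrite -[X in take X]sg take_size.
Qed.

Lemma lcs_sideE z : lcs_side mem0 T W h z =
  nseq (P * K) (~~ z : nat) ++ blocks K z [seq gadget mem0 T W h z a | a <- iota 0 P] ++
  nseq (P * K) (~~ z : nat).
Proof. by rewrite /lcs_side /select -(pk prm) -(pL prm) -(pK prm) -(pP prm). Qed.

Lemma size_blocks z c : c <= P ->
  size (blocks K z [seq gadget mem0 T W h z a | a <- iota 0 c]) = c * (ell + 2 * K).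
Proof.
move=> cP; rewrite /blocks -map_comp.
rewrite (@size_flatten_uniform _ _ _ _ (ell + 2 * K)) => [|a].
  by rewrite size_iota.
rewrite /= size_cat size_gadget -(pk prm) -(pell prm) /sep size_cat !size_nseq.
by lia.
Qed.

Definition side_cost :=
  10 + P * K * 32 + 5 + P * (5 + ell * (167 + k * 126) + 10 + K * 32 + 6).

Lemma wp_side z l st : glob st ->
  memory st = overlay mem0 Z l -> regs st 20 = Z + size l ->
  size l + N <= 2 * N + 1 ->
  wp w m (side z) st side_cost (fun st' =>
    memory st' = overlay mem0 Z (l ++ lcs_side mem0 T W h z) /\
    regs st' 20 = Z + size (l ++ lcs_side mem0 T W h z)).
Proof.
move=> g ml pl sl; facts.
have w2 : 1 < 2 ^ w by lia.
have boolw (b : bool) : (b : nat) < 2 ^ w by case: b; lia.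
set D := nseq (P * K) (~~ z : nat).
pose Bl c := blocks K z [seq gadget mem0 T W h z a | a <- iota 0 c].
apply: (@wp_cost _ _ _ _ (2 + 3 + P * K * 16 +
  ((2 + 3 + P * (5 + ell * (167 + k * 126) +
     ((2 + 3 + K * 16) + (2 + 3 + K * 16)) + 6)) +
   (2 + 3 + P * K * 16)))); first by rewrite /side_cost; lia.
apply: wp_seq; apply: wp_frame.
apply: wp_weaken (wp_fill (e := EVar 14) (l := l) (c := P * K) _ _ _ ml pl _) => //=.
- move=> st1 [m1 p1] off1.
  have g1 : glob st1 by apply: glob_off off1 g.
  apply: wp_seq; apply: (wp_for (n := P) (I := fun c st' =>
    memory st' = overlay mem0 Z (l ++ D ++ Bl c) /\
    regs st' 20 = Z + size (l ++ D ++ Bl c))).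
  + by rewrite /= g1 //=; lia.
  + by rewrite /= g1.
  + by rewrite /Bl /= !cats0.
  + move=> c st2 cP off2 [m2 p2].
    have c1P : c.+1 * (ell + 2 * K) <= P * (ell + 2 * K) by rewrite leq_mul2r cP orbT.
    rewrite mulSn in c1P.
    have sBl : size (l ++ D ++ Bl c) + (ell + 2 * K) + P * K <= size l + N.
      by rewrite !size_cat size_nseq size_blocks ?(ltnW cP) //; lia.
    have g2 : glob (set_reg st2 21 c).
      by apply: glob_set => //; apply: glob_off off2 g1; case: (z).
    apply: wp_seq; apply: wp_frame.
    apply: wp_weaken (wp_gadget z (a := c) (l := l ++ D ++ Bl c) g2 _ cP m2 p2 _) => //.
    * move=> st3 [m3 p3] off3.
      have g3 : glob st3 by apply: glob_off off3 g2; case: (z).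
      apply: wp_seq; apply: wp_frame.
      have sG : size ((l ++ D ++ Bl c) ++ gadget mem0 T W h z c) + 2 * K + P * K <= size l + N.
        by rewrite size_cat size_gadget -(pk prm) -(pell prm); lia.
      apply: wp_weaken (wp_fill (e := EVar 9) (x := z) (c := K) _ _ _ m3 p3 _) => //=.
      - move=> st4 [m4 p4] off4.
        have g4 : glob st4 by apply: glob_off off4 g3.
        apply: wp_weaken (wp_fill (e := EVar 9) (x := ~~ z) (c := K) _ _ _ m4 p4 _) => //=.
        + move=> st5 [-> ->].
          have -> : (((l ++ D ++ Bl c) ++ gadget mem0 T W h z c) ++ nseq K (z : nat)) ++
             nseq K (~~ z : nat) = l ++ D ++ Bl c.+1.
            rewrite /Bl -addn1 iotaD map_cat /blocks map_cat flatten_cat /=.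
            by rewrite /sep cats0 -!catA add0n.
          by [].
        + by rewrite g4.
        + by rewrite g4 //=; lia.
        + by rewrite size_cat size_nseq; lia.
      - by rewrite g3.
      - by rewrite g3 //=; lia.
      - by lia.
    * by lia.
  move=> st2 off2 [m2 p2].
  have g2 : glob st2 by apply: glob_off off2 g1; case: (z).
  have sBl : size (l ++ D ++ Bl P) + P * K <= size l + N.
    by rewrite !size_cat size_nseq size_blocks //; lia.
  apply: wp_weaken (wp_fill (e := EVar 14) (x := ~~ z) (c := P * K) _ _ _ m2 p2 _) => //=.
  + by move=> st3 [-> ->]; rewrite lcs_sideE -/D -!catA.
  + by rewrite g2.
  + by rewrite g2 //=; lia.
  + by lia.
- by rewrite g.
- by rewrite g //=; lia.
- by lia.
Qed.

Lemma wp_copy_down l st : glob st -> memory st = overlay mem0 Z l ->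
  size l = 2 * N + 1 -> all (fun x => x < 2 ^ w) l ->
  wp w m copy_down st (5 + Z * 30) (fun st' => memory st' = nth 0 l).
Proof.
move=> g ml sl /allP lw; facts.
apply: (@wp_cost _ _ _ _ (2 + 3 + Z * (2 + (2 + 2 + 1 + 1) + 1 + (2 + 2 + 1 + 1 + 1) + 6)));
  first by lia.
pose f := overlay mem0 Z l.
have fw c : f c < 2 ^ w.
  rewrite /f /overlay; case: ifP => cZ; last exact: mem_w.
  by apply/lw/mem_nth; case/andP: cZ => c1 c2; rewrite ltn_subLR.
apply: (wp_for (n := Z) (I := fun t st' => forall c, memory st' c =
   if c < t then f (Z + c) else if Z <= c < Z + t then 0 else f c)).
- by rewrite /= g //=; lia.
- by rewrite /= g.
- by move=> c; rewrite ml ltn0 addn0 ifF //; lia.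
- move=> t st1 tZ off i1.
  have g1 : glob (set_reg st1 37 t).
    by apply: glob_set => //; apply: glob_off off g.
  have r13 := g1 13 isT; rewrite /= /update /= in r13.
  have rd : memory st1 (Z + t) = f (Z + t) by rewrite i1 !ifF //; lia.
  apply: wp_seq; apply: wp_store; rewrite /= /update /= ?r13.
  + lia.
  + by rewrite rd; fit => //; lia.
  apply: wp_store; rewrite /= /update /= ?r13.
  + by fit; lia.
  + lia.
  move=> c; rewrite rd i1.
  case: (c =P Z + t) => [->|n1]; first by rewrite ifF ?ifT //; lia.
  case: (c =P t) => [->|n2]; first by rewrite ifT.
  have -> : (c < t.+1) = (c < t) by lia.
  by have -> : (Z <= c < Z + t.+1) = (Z <= c < Z + t) by lia.
move=> st1 off i1; apply/funext => c; rewrite i1.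
case: ltnP => cZ.
  rewrite /f /overlay leq_addr ltn_add2l /= addKn; case: ltnP => // lc.
  by rewrite mem_sz ?nth_default //; lia.
rewrite nth_default; last by lia.
case: ifP => // c2; rewrite /f /overlay ifF ?mem_sz //; lia.
Qed.

Lemma lcs_side_fits z : all (fun x => x < 2 ^ w) (lcs_side mem0 T W h z).
Proof.
facts; have boolw (b : bool) : (b : nat) < 2 ^ w by case: b; lia.
have nw c (b : bool) : all (fun x => x < 2 ^ w) (nseq c (b : nat)).
  by apply/allP => y; rewrite mem_nseq => /andP[_ /eqP->].
rewrite lcs_sideE !all_cat !nw andbT /=.
apply/allP => y /flattenP [s /mapP [X /mapP [a _ ->] ->]].
rewrite mem_cat => /orP[|]; last by move: y; apply/allP; rewrite /sep all_cat !nw.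
move=> /leaves_range; rewrite -(pk prm) mul0n mul1n -(pell prm).
by case: (z) => - [|]; lia.
Qed.

Definition instance_list := N :: lcs_side mem0 T W h false ++ lcs_side mem0 T W h true.

Lemma size_side z : size (lcs_side mem0 T W h z) = N.
Proof. by rewrite size_lcs_side -(pk prm) -(pL prm) -(pK prm) -(pP prm) -(pell prm) (pN prm). Qed.

Lemma wp_parameters st N2 p (Q : state -> Prop) :
  regs st 0 = n -> regs st 1 = T -> regs st 2 = W -> regs st 3 = E ->
  (forall st', memory st' = memory st -> glob st' -> regs st' 20 = Z ->
     wp w m p st' N2 Q) ->
  wp w m (PSeq parameters p) st (100 + T * 50 + N2) Q.
Proof.
move=> e0 e1 e2 e3 hQ; apply: wp_seq; facts.
have T1 := pT prm; have eE := pE prm; have W0 := pW prm; have eL := pL prm.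
have ek := pk prm; have eell := pell prm; have esz := psz prm; have eN := pN prm.
apply: wp_cost; last first.
apply: (wp_assign_to (x := h)).
- by rewrite /= e0; fit; rewrite -?(addn1 n) //; lia.
- by rewrite /= e0 (ph prm) addn1.
apply: (wp_assign_to (x := P)); rewrite /= /update /= ?mul1n -?(pP prm).
- by fit => //; lia.
- by [].
apply: (wp_assign_to (x := 1)) => //=; first by lia.
apply: (wp_assign_to (x := 0)) => //=; first by lia.
apply: (wp_assign_to (x := 1)) => //=; first by lia.
set st0 := set_reg _ 8 1.
have i0 : [/\ memory st0 = memory st, regs st0 4 = h, regs st0 5 = P,
   [/\ regs st0 0 = n, regs st0 1 = T, regs st0 2 = W & regs st0 3 = E] &
   [/\ regs st0 6 = 1, regs st0 7 = 0 & regs st0 8 = 1]] by [].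
move: st0 i0 => st0 [m0 s4 s5 [s0 s1 s2 s3] [s6 s7 s8]].
pose inv i st' := memory st' = memory st /\
  exists j, [/\ j = minn i k, regs st' 6 = 2 ^ j, regs st' 7 = j & regs st' 8 = W.*2 ^ j].
apply: wp_seq; apply: (wp_for (n := T) (I := inv)).
- by rewrite /= s1; lia.
- by [].
- by split=> //; exists 0; rewrite min0n.
- move=> i st1 iT off [m1 [j [ej r6 r7 r8]]].
  have r1 : regs st1 1 = T by rewrite off.
  have r2 : regs st1 2 = W by rewrite off.
  have jk : j <= k by rewrite ej geq_minr.
  have jL : 2 ^ j <= L by rewrite eL leq_pexp2l.
  have jell : W.*2 ^ j <= ell by rewrite eell leq_pexp2l // double_gt0.
  apply: wp_if2; rewrite /= /update /= ?r6 ?r1.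
  + by fit; [lia | lia | case: (_ < T); lia].
  + move=> jT.
    have jk1 : j < k.
      rewrite ltnNge; apply/negP => kj; have jk' : j = k by lia.
      by move: jT; rewrite jk' -eL; case: ltnP => //; lia.
    have jL1 : 2 ^ j * 2 <= L by rewrite -expnSr eL leq_exp2l.
    have jell1 : W.*2 ^ j * W.*2 <= ell by rewrite -expnSr eell leq_pexp2l // double_gt0.
    apply: (wp_assign_to (x := 2 ^ j.+1)); rewrite /= /update /= ?r6 ?r7 ?r8 ?r2.
    - by fit; lia.
    - by rewrite expnSr; lia.
    apply: (wp_assign_to (x := j.+1)); rewrite /= /update /= ?r6 ?r7 ?r8 ?r2.
    - by fit; lia.
    - by rewrite addn1.
    apply: wp_assign; rewrite /= /update /= ?r6 ?r7 ?r8 ?r2.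
    - by fit; rewrite ?addnn; lia.
    split=> //; exists j.+1; split=> //; last by rewrite addnn -expnSr.
    by rewrite ej; move: jk1; rewrite ej; lia.
  + move=> jT; apply: wp_skip; split=> //; exists j; split=> //.
    (* A failed guard means that T is at most 2^j, and [k] is the least such exponent. *)
    have jk' : j = k.
      apply/eqP; rewrite eqn_leq jk leqNgt; apply/negP => jk1.
      have := up_log_gtn (isT : 1 < 2) T1; rewrite -ek => kT.
      have : 2 ^ j <= 2 ^ k.-1 by rewrite leq_pexp2l //; lia.
      by move: jT; case: ltnP => // jT _; lia.
    by move: ej jk' ; lia.
move=> st1 off [m1 [j [ej r6 r7 r8]]].
(* After T rounds j = min(T, k), and T < 2^T gives k at most T. *)
have ejk : j = k.
  by rewrite ej; apply/minn_idPr; rewrite ek up_log_min // ltnW // ltn_expl.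
have t0 : regs st1 0 = n by rewrite off.
have t1 : regs st1 1 = T by rewrite off.
have t2 : regs st1 2 = W by rewrite off.
have t3 : regs st1 3 = E by rewrite off.
have t4 : regs st1 4 = h by rewrite off.
have t5 : regs st1 5 = P by rewrite off.
rewrite ejk -eL in r6; rewrite ejk in r7; rewrite ejk -eell in r8.
have regsE := (t0, t1, t2, t3, t4, t5, r6, r7, r8).
have K_PK : K <= P * K by rewrite leq_pmull.
have ellN : ell + 4 * K <= N by rewrite eN leq_pmull.
have EW : E * W <= E * W * W by rewrite leq_pmulr.
apply: (wp_assign_to (x := K)); rewrite /= /update /= ?regsE.
- by fit; lia.
- lia.
apply: (wp_assign_to (x := P * K)); rewrite /= /update /= ?regsE.
- by fit; lia.
- by [].
apply: (wp_assign_to (x := N)); rewrite /= /update /= ?regsE.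
- by fit; rewrite -?eN; lia.
- by rewrite eN.
apply: (wp_assign_to (x := 2 * (P * K))); rewrite /= /update /= ?regsE.
- by fit; lia.
- by [].
apply: (wp_assign_to (x := sz)); rewrite /= /update /= ?regsE.
- by fit; lia.
- by rewrite esz.
apply: (wp_assign_to (x := Z)); rewrite /= /update /= ?regsE.
- by fit; lia.
- by lia.
apply: wp_assign; rewrite /= /update /=; first by lia.
apply: hQ => //.
  by do 15?[case=> [_|]]; rewrite //= /update /= ?regsE.
rewrite /=; lia.
Qed.

Definition reduction_cost := 120 + T * 50 + 2 * side_cost + Z * 30.

Lemma wp_reduction st : memory st = mem0 ->
  regs st 0 = n -> regs st 1 = T -> regs st 2 = W -> regs st 3 = E ->
  wp w m reduction st reduction_cost (fun st' =>
    memory st' = nth 0 instance_list /\ regs st' 11 = 2 * (P * K)).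
Proof.
move=> ms e0 e1 e2 e3; facts.
apply: (@wp_cost _ _ _ _ (100 + T * 50 + ((2 + 9) + (side_cost + (side_cost + (5 + Z * 30))))));
  first by rewrite /reduction_cost; lia.
apply: wp_parameters => // st1 m1 g1 p1.
apply: wp_seq; apply: wp_frame.
apply: wp_weaken (wp_emit (e := EVar 10) (l := [::]) _ erefl _ _ _ _) => //=.
- move=> st2 [m2 p2] off2; have g2 : glob st2 by apply: glob_off off2 g1.
  rewrite g1 //= in m2.
  apply: wp_seq; apply: wp_frame.
  apply: wp_weaken (wp_side false g2 m2 p2 _) => //=; last by lia.
  move=> st3 [m3 p3] off3; have g3 : glob st3 by apply: glob_off off3 g2.
  apply: wp_seq; apply: wp_frame.
  apply: wp_weaken (wp_side true g3 m3 p3 _) => //=; last first.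
    by rewrite size_side; lia.
  move=> st4 [m4 p4] off4; have g4 : glob st4 by apply: glob_off off4 g3.
  apply: wp_frame.
  apply: wp_weaken (wp_copy_down g4 m4 _ _) => //=.
  + move=> st5 m5 off5; split; first by rewrite m5 /instance_list.
    by rewrite off5 ?g4.
  + by rewrite size_cat !size_side; lia.
  + by rewrite all_cat !lcs_side_fits !andbT; lia.
- by rewrite g1 //=; lia.
- rewrite m1 ms; apply/funext => c; rewrite /overlay ifF //=; lia.
- by rewrite addn0.
Qed.
End Verification.

(** * Time and size bounds *)

(** Number of gadget symbols on a side times a bound for the input size. A product is wasteful, but
    it dominates sizes, addresses and time at once and costs only a factor T W^2, which the exponent
    absorbs. *)
Definition volume n T W :=
  2 ^ (n.+1 %/ 2) * W.*2 ^ up_log 2 T * (T * W * W).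

Lemma params_volume n T W E h P L k ell K N sz Z :
  params n T W E h P L k ell K N sz Z ->
  [/\ N <= 5 * volume n T W, 2 * Z + 10 <= 50 * volume n T W &
      reduction_cost T P k ell K Z <= 1500 * volume n T W].
Proof.
move=> prm; case: (params_bounds prm).
case=> P0 k0 ell0 Lell PN; case=> ellN kL hP nP TL.
case=> W2ell PKN Nsum L1 LK; case=> szZ eZ WN EN hN.
have T1 := pT prm; have W0 := pW prm.
have kT : k <= T by rewrite (pk prm) up_log_min // ltnW // ltn_expl.
rewrite /volume -(ph prm) -(pk prm) -(pP prm) -(pell prm).
set A := P * ell; set V := A * (T * W * W).
have A0 : 0 < A by rewrite muln_gt0 P0.
have TWW : T <= T * W * W by rewrite -mulnA leq_pmulr // muln_gt0 W0.
have AV : A * T <= V by rewrite leq_mul2l TWW orbT.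
have AA : A * 2 <= A * T by rewrite leq_mul2l T1 orbT.
have TV : T * W * W <= V by rewrite leq_pmull.
have PKA : P * K <= A by rewrite leq_mul2l; apply/orP; right; lia.
have PA : P <= A by rewrite leq_pmulr.
have NA : N <= 5 * A by rewrite (pN prm) mulnDr -/A mulnCA; lia.
have EWW : E * W * W <= T * W * W.
  by rewrite -(pE prm) !leq_mul2r leq_pred !orbT.
have ET : E <= T by rewrite -(pE prm) leq_pred.
have szV : sz <= 6 * V by rewrite (psz prm); lia.
have ZV : Z <= 17 * V by lia.
split; [by lia | by lia |].
(* Decoding a symbol takes k rounds, and the spare factor T pays for them. *)
have PellkA : P * (ell * k) <= A * T by rewrite mulnA leq_mul2l kT orbT.
rewrite /reduction_cost /side_cost.
have -> : P * (5 + ell * (167 + k * 126) + 10 + K * 32 + 6) =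
  21 * P + 167 * A + 126 * (P * (ell * k)) + 32 * (P * K).
  by rewrite /A; ring.
move: (P * (ell * k)) (P * K) (T * W * W) (A * T) PellkA PKA TWW AV AA TV {Nsum PKN NA EWW eZ}.
by move=> *; lia.
Qed.

Definition lcs_of (N : nat) (a b : seq nat) (ha : size a == N) (hb : size b == N) :
  lcs_instance := LCSInstance (Tuple ha) (Tuple hb).

Lemma LCS_nseq N l : is_LCS_length (nseq N 0) (nseq N 0) l -> l = N.
Proof.
case=> [[s [s1 _ <-]] h]; apply/eqP; rewrite eqn_leq.
have := size_subseq s1; rewrite size_nseq => -> /=.
by have := h (nseq N 0) (subseq_refl _) (subseq_refl _); rewrite size_nseq.
Qed.

Lemma LCS_set_nth N j l : j < N ->
  is_LCS_length (nseq N 0) (set_nth 0 (nseq N 0) j 1) l -> l <> N.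
Proof.
move=> jN [[s [s1 s2 es]] _] lN; move: es; rewrite lN => es.
have sb : size (set_nth 0 (nseq N 0) j 1) = N.
  by rewrite size_set_nth size_nseq (maxn_idPr jN).
have e1 := size_subseq_leqif s1; have e2 := size_subseq_leqif s2.
have {e1}/eqP e1 : s == nseq N 0 by rewrite -e1 es size_nseq.
have {e2}/eqP e2 : s == set_nth 0 (nseq N 0) j 1 by rewrite -e2 es sb.
have : nth 0 s j = 1 by rewrite e2 nth_set_nth /= eqxx.
by rewrite e1 nth_nseq jN.
Qed.

Lemma params_exist n T W : 1 < T -> 0 < W ->
  exists E h P L k ell K N sz Z, params n T W E h P L k ell K N sz Z.
Proof. by move=> T1 W0; do 10!eexists; split. Qed.

(** With a single layer the start and accept nodes coincide, hence the constant answer 1. The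
    successor in [m] puts the output register 0 among those that [exec_regs] tracks; the threshold,
    variable 11, lies above them and survives the run of [c]. *)
Definition bp_sat_cmd (c : cmd) : cmd :=
  let m := (reg_bound c).+1 in
  CSeq (compile m 0 read_header)
    (CIf (var m 3)
      (CSeq (compile m 0 reduction) (CSeq c (COp OpLt 0 (var m 11) 0)))
      (CConst 0 1)).

Lemma init_sees m input : sees m (init_state input) (init_state input).
Proof. by []. Qed.

Lemma wp_read_header w m (B : bp) : 2 < 2 ^ w -> all (fun v => v < 2 ^ w) (bp_encoding B) ->
  wp w m read_header (init_state (bp_encoding B)) 20 (fun st =>
    [/\ memory st = nth 0 (bp_encoding B), regs st 0 = bp_vars B,
        regs st 1 = bp_length B, regs st 2 = bp_width B &
        regs st 3 = (bp_length B).-1]).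
Proof.
move=> w2 /allP enc_w.
have nw : bp_vars B < 2 ^ w by apply: enc_w; rewrite !inE eqxx.
have Tw : bp_length B < 2 ^ w by apply: enc_w; rewrite !inE eqxx orbT.
have Ww : bp_width B < 2 ^ w by apply: enc_w; rewrite !inE eqxx !orbT.
have T0 := bp_length_gt0 B.
apply: wp_cost; last first.
  apply: (wp_assign_to (x := bp_vars B)) => //=; first by split=> //; lia.
  apply: (wp_assign_to (x := bp_length B)) => //=; first by split=> //; lia.
  apply: (wp_assign_to (x := bp_width B)) => //=.
  by apply: wp_assign; rewrite /= /update /= ?subn1 //; fit; lia.
by [].
Qed.

Lemma sat_length1 (B : bp) : bp_length B = 1 -> bp_satisfiable B.
Proof.
move=> T1; apply/existsP; exists [ffun=> false]; rewrite /bp_accepts.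
rewrite (_ : bp_accept B = bp_start B) ?connect0 //.
by congr (_, _); apply: val_inj; rewrite /= T1.
Qed.

Lemma lcs_decides (B : bp) h l : bp_vars B <= h.*2 ->
  let side := lcs_side (nth 0 (bp_encoding B)) (bp_length B) (bp_width B) h in
  is_LCS_length (side false) (side true) l ->
  bp_satisfiable B = (2 * (2 ^ h * (2 ^ up_log 2 (bp_length B)).-1) < l).
Proof.
move=> nh side [[s [s1 s2 sl]] lmax]; apply/idP/idP.
  case/(sat_lcs_sides nh) => t /andP[t1 t2] ht.
  by apply: leq_trans ht _; apply: lmax.
by move=> lt; apply/(sat_lcs_sides nh); exists s; rewrite ?sl // /common s1.
Qed.

Lemma bp_sat_run w c (B : bp) E h P L k ell K N sz Z t s :
  params (bp_vars B) (bp_length B) (bp_width B) E h P L k ell K N sz Z ->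
  all (fun v => v < 2 ^ w) (bp_encoding B) -> 2 * Z + 10 < 2 ^ w ->
  exec w c (init_state (instance_list (nth 0 (bp_encoding B))
    (bp_length B) (bp_width B) h N)) t s ->
  exists2 t', t' <= 22 + reduction_cost (bp_length B) P k ell K Z + t &
    exists2 s', exec w (bp_sat_cmd c) (init_state (bp_encoding B)) t' s' &
      output s' = (2 * (P * K) < output s).
Proof.
move=> prm enc_w Zw xc; set m := (reg_bound c).+1.
have mem_w a : nth 0 (bp_encoding B) a < 2 ^ w.
  have [lt|ge] := ltnP a (size (bp_encoding B)); last by rewrite nth_default //; lia.
  by move/allP: enc_w; apply; apply: mem_nth.
have mem_sz a : sz <= a -> nth 0 (bp_encoding B) a = 0.
  move=> sza; apply: nth_default; rewrite size_bp_encoding.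
  by move: sza; rewrite (psz prm) -(pE prm); lia.
have w1 : 2 < 2 ^ w by lia.
have [t1 [s1 [st1 [x1 c1 ss1 k1 [_ [m1 e0 e1 e2 e3]]]]]] :=
  @wp_read_header w m B w1 enc_w 0 _ (init_sees m (bp_encoding B)).
rewrite (pE prm) in e3.
have [t2 [s2 [st2 [x2 c2 ss2 k2 [_ [m2 e11]]]]]] :=
  wp_reduction (m := m) prm mem_w mem_sz Zw m1 e0 e1 e2 e3 0 ss1.
have ag : agree m (init_state (instance_list (nth 0 (bp_encoding B))
    (bp_length B) (bp_width B) h N)) s2.
  split=> [r rm|]; last by rewrite (proj2 ss2) m2.
  by rewrite (proj1 k2) ?(proj1 k1).
have [s3 [x3 ag3 f3]] := exec_regs xc (leqnSn _ : reg_bound c <= m) ag.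
exists (t1 + (t2 + (t + 1)).+1); first by lia.
exists (set_reg s3 0 (eval_binop w OpLt (regs s3 (var m 11)) (regs s3 0))).
  apply: (ExecSeq x1); apply: ExecIfTrue.
    rewrite (proj1 ss1) e3 -(pE prm) -lt0n -subn1 subn_gt0; exact: (pT prm).
  by apply: (ExecSeq x2); apply: (ExecSeq x3); apply: ExecOp.
rewrite /output regs_set f3; last by rewrite /var leq_addr.
rewrite (proj1 ss2) e11 (proj1 ag3) // /eval_binop modn_small //.
by apply: leq_ltn_trans (leq_b1 _) _; lia.
Qed.

(** * Real bounds and the running time *)

Local Open Scope ring_scope.

Section RealBound.
Variable R : realType.

Definition target (n T W : nat) : R :=
  2 `^ (n%:R / 2) * T%:R `^ (11 * Num.max 1 (log2 R W)).

Lemma two_powR_log2 (W : nat) : (0 < W)%N -> 2 `^ log2 R W = W%:R :> R.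
Proof.
move=> W0; rewrite /powR ifF; last by apply/negbTE; rewrite pnatr_eq0.
rewrite /log2 divfK; first by rewrite lnK // posrE ltr0n.
by rewrite gt_eqF // ln_gt0 // ltr1n.
Qed.

(** Origin of 11, with lam = max(1, log W): T^3 is slack for constants, T pays for rounding n/2 up,
    T for the layers, T^2 bounds 2^k, T^(2 lam) bounds W^k and T^(2 lam) bounds W^2. In total 7 + 4
    lam is at most 11 lam. *)
Lemma volume_target n T W : (1 < T)%N -> (0 < W)%N ->
  (T ^ 3 * volume n T W)%:R <= target n T W.
Proof.
move=> T1 W0; rewrite /target /volume; set lam := Num.max _ _.
have lam1 : 1 <= lam by rewrite le_max lexx.
have T2 : 2 <= T%:R :> R by rewrite ler_nat.
have T0 : 0 < T%:R :> R by lra.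
have Tn0 : T%:R != 0 :> R by rewrite gt_eqF.
have T1' : 1 <= T%:R :> R by lra.
have TX j : T%:R ^+ j = T%:R `^ j%:R :> R by rewrite powR_mulrn // ltW.
have WT : W%:R <= T%:R `^ lam.
  rewrite -(two_powR_log2 W0); apply: (@le_trans _ _ (2 `^ lam)).
    by rewrite ler_powR ?ler1n // le_max lexx orbT.
  by rewrite ge0_ler_powR // ?nnegrE //; lra.
set k := up_log 2 T.
have kT : (2 ^ k <= T * T)%N.
  have := up_log_gtn (isT : 1 < 2)%N T1; rewrite -/k => h.
  have k0 : (0 < k)%N by rewrite up_log_gt0.
  rewrite -(prednK k0) expnS; apply: leq_mul => //; exact: ltnW.
have kTR : 2 ^+ k <= T%:R `^ 2 :> R.
  by rewrite -(TX 2%N) expr2 -natrM -natrX ler_nat.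
have WkT : W%:R ^+ k <= T%:R `^ (2 * lam) :> R.
  apply: (@le_trans _ _ ((2 `^ lam) ^+ k)).
    apply: lerXn2r; rewrite ?nnegrE ?powR_ge0 ?ler0n //.
    by rewrite -(two_powR_log2 W0) ler_powR ?ler1n // le_max lexx orbT.
  rewrite -powR_mulrn ?powR_ge0 // powRAC powR_mulrn ?ler0n // powRrM.
  by rewrite ge0_ler_powR ?nnegrE ?exprn_ge0 ?powR_ge0 //; lra.
have hn : (2 ^ (n.+1 %/ 2))%:R <= 2 `^ (n%:R / 2) * T%:R :> R.
  rewrite natrX -powR_mulrn ?ler0n //.
  apply: (@le_trans _ _ (2 `^ (n%:R / 2 + 1))).
    rewrite ler_powR ?ler1n //.
    have : (2 * (n.+1 %/ 2) <= n + 1)%N by lia.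
    by rewrite -(ler_nat R) natrM natrD; lra.
  rewrite powRD ?powRr1 ?ler0n //; last by rewrite pnatr_eq0 implybT.
  by rewrite ler_wpM2l // powR_ge0.
rewrite (_ : W.*2 ^ k = 2 ^ k * W ^ k)%N; last by rewrite -mul2n expnMn.
rewrite natrM [(T ^ 3)%:R]natrX !natrM [(2 ^ k)%:R]natrX [(W ^ k)%:R]natrX.
set p := 2 `^ (n%:R / 2) in hn *.
have p0 : 0 <= p by exact: powR_ge0.
apply: (@le_trans _ _ (T%:R ^+ 3 * ((p * T%:R) * (T%:R `^ 2 * T%:R `^ (2 * lam)) *
   (T%:R * T%:R `^ lam * T%:R `^ lam)))).
  rewrite ler_wpM2l ?exprn_ge0 ?ler0n //.
  apply: ler_pM; rewrite ?mulr_ge0 ?ler0n ?exprn_ge0 //.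
    apply: ler_pM; rewrite ?mulr_ge0 ?exprn_ge0 ?ler0n //.
    by apply: ler_pM; rewrite ?exprn_ge0 ?ler0n.
  apply: ler_pM; rewrite ?mulr_ge0 ?ler0n //.
  by apply: ler_pM; rewrite ?ler0n.
have -> : T%:R ^+ 3 * (p * T%:R * (T%:R `^ 2 * T%:R `^ (2 * lam)) *
    (T%:R * T%:R `^ lam * T%:R `^ lam)) =
  p * (T%:R ^+ 5 * (T%:R `^ 2 * (T%:R `^ (2 * lam) * (T%:R `^ lam * T%:R `^ lam)))).
  by ring.
rewrite ler_wpM2l // TX -!powRD ?Tn0 ?implybT //.
by rewrite ler_powR //; lra.
Qed.

Lemma target_ge1 n T W : (0 < T)%N -> 1 <= target n T W.
Proof.
move=> T0; rewrite /target; set lam := Num.max _ _.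
have lam1 : 1 <= lam by rewrite le_max lexx.
have T1 : 1 <= T%:R :> R by rewrite ler1n.
have h1 : 1 <= 2 `^ (n%:R / 2) :> R.
  by rewrite -[X in X <= _](powRr0 2) ler_powR ?ler1n // divr_ge0.
have h2 : 1 <= T%:R `^ (11 * lam) :> R.
  by rewrite -[X in X <= _](powRr0 T%:R) ler_powR //; lra.
by rewrite -[X in X <= _]mulr1 ler_pM.
Qed.

End RealBound.

Lemma le_expn2 (R : realType) (x : R) : exists w : nat, x <= (2 ^ w)%:R.
Proof.
have [x0|x0] := leP 0 x; last first.
  by exists 0%N; rewrite (le_trans (ltW x0)).
exists (Num.bound x); apply: ltW; apply: lt_trans (archi_boundP x0) _.
by rewrite ltr_nat ltn_expl.
Qed.

(* An algorithm that stops before reading all of the second sequence cannot tell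
   0 ... 0 from the sequence with a 1 in an unread cell. *)
Lemma LCS_time_lower_bound (R : realType) (S : R -> R) c C k :
  (forall (x : instance LCS) (w : nat),
    all (fun v => (v < 2 ^ w)%N) (encoding x) ->
    ((size (encoding x))%:R + S (lcs_length x)%:R + 2) ^+ k <= (2 ^ w)%:R ->
    exists (steps : nat) (s : state),
      [/\ exec w c (init_state (encoding x)) steps s,
          (steps%:R <= C%:R * (S (lcs_length x)%:R + 1))%R
        & answer x (output s)]) ->
  forall N, N%:R <= C%:R * (S N%:R + 1).
Proof.
move=> solve N.
have [w0 hw0] := le_expn2 (((1 + (N + N))%:R + S N%:R + 2) ^+ k).
(* The additional bits make the entry N and the symbols 0 and 1 fit into a word. *)
pose w := (w0 + N.+2)%N.
have Nw : (N.+2 < 2 ^ w)%N.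
  by rewrite (leq_trans (ltn_expl N.+2 (isT : 1 < 2)%N)) // leq_exp2l // leq_addl.
have hw : ((1 + (N + N))%:R + S N%:R + 2) ^+ k <= (2 ^ w)%:R.
  by rewrite (le_trans hw0) // ler_nat leq_exp2l // leq_addr.
have sa : size (nseq N 0%N) == N by rewrite size_nseq.
have all0 : all (fun v => (v < 2 ^ w)%N) (nseq N 0%N).
  by apply/allP => y; rewrite mem_nseq => /andP[_ /eqP->]; lia.
have [||t [s [x tC ans]]] := solve (lcs_of sa sa) w.
- by rewrite /= all_cat all0 andbT andbT; lia.
- by rewrite /= size_cat size_nseq.
apply: le_trans tC; rewrite ler_nat leqNgt; apply/negP => tN.
have [A At frame] := exec_reads x.
(* The second sequence occupies N cells and fewer than N are read. *)
have [j jN jA] : exists2 j, (j < N)%N & (1 + N + j)%N \notin A.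
  have [/allP h|/allPn [j jN jA]] :=
    boolP (all (fun j => (1 + N + j)%N \in A) (iota 0 N)); last first.
    by exists j => //; move: jN; rewrite mem_iota.
  have : (size [seq (1 + N + j)%N | j <- iota 0 N] <= size A)%N.
    apply: uniq_leq_size; first by rewrite map_inj_uniq ?iota_uniq // => a b /addnI.
    by move=> y /mapP [j /h jA ->].
  by rewrite size_map size_iota; lia.
have sb : size (set_nth 0%N (nseq N 0%N) j 1%N) == N.
  by rewrite size_set_nth size_nseq (maxn_idPr jN).
have [||t' [s' [x' _ ans']]] := solve (lcs_of sa sb) w.
- rewrite /= all_cat all0 /=; apply/andP; split; first by lia.
  apply/(all_nthP 0%N) => i _; rewrite nth_set_nth /= nth_nseq.
  by case: eqP => _; [|case: ifP => _]; lia.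
- by rewrite /= size_cat (eqP sb) size_nseq.
have [||s2 [x2 r2 _]] := frame (init_state (encoding (p := LCS) (lcs_of sa sb))) => //.
  move=> a aA /=; case: a aA => [//|a] aA /=.
  rewrite !nth_cat size_nseq; case: ltnP => // Na.
  rewrite nth_set_nth /=; case: eqP => // ej.
  by move: jA aA; rewrite -ej add1n addSn subnKC // => /negP.
(* By determinism both runs give the same output, which is N for the first instance and cannot be N
   for the second. *)
have [_ es] := exec_det x' x2; subst s2.
apply: (LCS_set_nth jN ans'); rewrite /output r2.
exact: LCS_nseq ans.
Qed.

Lemma nat_le_expr (R : realType) (Y : R) c : 4 <= Y -> c%:R <= Y ^+ c.
Proof.
move=> Y4; apply: (@le_trans _ _ (2 ^+ c)).
  by rewrite -natrX ler_nat ltnW // ltn_expl.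
by apply: lerXn2r; rewrite ?nnegrE; lra.
Qed.

(* The lower bound 1 on log W only changes W = 1, where T ^ (c log W) = 1
   would leave no time to read the T layers. *)
Theorem theorem2 (R : realType) :
  exists c : R, forall S : R -> R,
    (forall x y : R, 1 <= x -> x <= y -> S x <= S y) ->
    solvable_in (p := LCS) (fun I => S (lcs_length I)%:R) ->
    solvable_in (p := BP_SAT) (fun B =>
      S (2 `^ ((bp_vars B)%:R / 2) *
         (bp_length B)%:R `^ (c * Num.max 1 (log2 R (bp_width B))))).
Proof.
exists 11 => S S_mono [c [C [k solve]]].
have lower := LCS_time_lower_bound solve.
have C0 : (0 < C)%N.
  by rewrite lt0n; apply/negP => /eqP C0; have := lower 1%N; rewrite C0 mul0r; lra.
have C1 : 1 <= C%:R :> R by rewrite ler1n.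
(* The LCS instance needs the k-th power of a quantity at most Y^(2C+5), where Y is the base of the
   word-length condition. Using k+1 instead of k keeps Y^(2C+5) within 2^w even if k = 0. *)
exists (bp_sat_cmd c), (6000 * C)%N, ((2 * C + 5) * k.+1)%N => B w enc_w.
rewrite -/(target R (bp_vars B) (bp_length B) (bp_width B)).
set M := target R _ _ _ => wordY.
have M1 : 1 <= M by apply: target_ge1; apply: bp_length_gt0.
(* The lower bound only speaks of integers, so it is applied to N0, the floor of M; since N0 is at
   least 1, M < N0 + 1 costs a factor 2. *)
have MC : M <= 2 * C%:R * (S M + 1).
  have M0 : 0 <= M by lra.
  have /andP[tM Mt] := truncn_itv M0; set N0 := Num.truncn M in tM Mt.
  have N1 : 1 <= N0%:R :> R by rewrite ler1n truncn_gt0.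
  have := lower N0; have := S_mono _ _ N1 tM => SN low.
  have : C%:R * (S N0%:R + 1) <= C%:R * (S M + 1) by rewrite ler_wpM2l //; lra.
  by move: Mt; rewrite -natr1; lra.
(* Values of S may be negative a priori; positivity here comes from the lower bound. *)
have SM0 : 0 < S M + 1.
  by rewrite -(pmulr_rgt0 _ (_ : 0 < 2 * C%:R)); lra.
set Y := (_ + _ + 2) in wordY.
have size3 : 3 <= (size (encoding (p := BP_SAT) B))%:R :> R.
  by rewrite ler_nat [size _](size_bp_encoding B) -!addnA leq_addr.
have Y4 : 4 <= Y by rewrite /Y; lra.
have Ypow j j' : (j <= j')%N -> Y ^+ j <= Y ^+ j' by apply: ler_weXn2l; lra.
(* The factor 2C is at most Y^(2C) and the factor S M + 1 at most Y. *)
have MY : M <= Y ^+ (2 * C + 1).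
  apply: le_trans MC _; rewrite exprD expr1 -natrM; apply: ler_pM; rewrite ?ler0n //.
  - lra.
  - exact: nat_le_expr.
  - by rewrite /Y; lra.
have Y_w : Y ^+ (2 * C + 5) <= (2 ^ w)%:R.
  by apply: le_trans wordY; apply: Ypow; rewrite leq_pmulr.
have w44 : (10 < 2 ^ w)%N.
  rewrite -(ltr_nat R); apply: lt_le_trans Y_w.
  apply: lt_le_trans (Ypow 2 _ _); last by clear; lia.
  by rewrite expr2; clear -Y4; nra.
have [T1|T1] := eqVneq (bp_length B) 1%N.
  have [t1 [s1 [st1 [x1 c1 ss1 k1 [_ [m1 e0 e1 e2 e3]]]]]] :=
    @wp_read_header w (reg_bound c).+1 B (leq_trans (isT : 2 < 11) w44)%N enc_w 0 _ (init_sees _ _).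
  exists (t1 + 2)%N, (set_reg s1 0 (1 %% 2 ^ w)); split.
  - apply: (ExecSeq x1); apply: ExecIfFalse; last exact: ExecConst.
    by rewrite (proj1 ss1) e3 T1.
  - have : (t1 + 2)%:R <= 22 :> R by rewrite ler_nat; clear -c1; lia.
    have : (6000 * C)%:R * (S M + 1) = 3000 * (2 * C%:R * (S M + 1)) by rewrite natrM; ring.
    by lra.
  - change (regs (set_reg s1 0 (1 %% 2 ^ w)) 0%N = bp_satisfiable B :> nat).
    by rewrite regs_set (sat_length1 T1) modn_small //; clear -w44; lia.
have {}T1 : (1 < bp_length B)%N by rewrite ltn_neqAle eq_sym T1 bp_length_gt0.
have [E [h [P [L [kk [ell [K [N [sz [Z prm]]]]]]]]]] :=
  params_exist (bp_vars B) T1 (bp_width_gt0 B).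
set n := bp_vars B in prm; set T := bp_length B in T1 prm; set W := bp_width B in prm.
have [NV ZV costV] := params_volume prm.
(* The slack T^3 is at least 8 because T is at least 2. *)
have VM : (8 * volume n T W)%:R <= M.
  apply: le_trans (volume_target R n T1 (bp_width_gt0 B)).
  by rewrite ler_nat leq_mul2r (leq_exp2r 2 T (isT : 0 < 3)%N) T1 orbT.
have NM : N%:R <= M by apply: le_trans VM; rewrite ler_nat; clear -NV; lia.
have N1 : 1 <= N%:R :> R.
  by have [[P0 _ _ _ PN] _ _ _] := params_bounds prm; rewrite ler1n (leq_trans P0).
have Zw : (2 * Z + 10 < 2 ^ w)%N.
  rewrite -(ltr_nat R); apply: lt_le_trans Y_w.
  apply: (@le_lt_trans _ _ (7 * M)).
    apply: le_trans (_ : (7 * (8 * volume n T W))%:R <= _).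
      by rewrite ler_nat; clear -ZV; lia.
    by rewrite natrM ler_wpM2l.
  have -> : (2 * C + 5 = 4 + (2 * C + 1))%N by clear; lia.
  rewrite exprD; apply: (@lt_le_trans _ _ (Y ^+ 4 * M)).
    rewrite ltr_pM2r; last by lra.
    by apply: lt_le_trans (Ypow 2 4 isT)%N; rewrite expr2; clear -Y4; nra.
  by rewrite ler_wpM2l // exprn_ge0 //; lra.
have sx z : size (lcs_side (nth 0%N (bp_encoding B)) T W h z) == N.
  by rewrite (size_side _ prm).
pose I : lcs_instance := lcs_of (sx false) (sx true).
have lowN := lower N.
have SN0 : 0 < S N%:R + 1.
  by rewrite -(pmulr_rgt0 _ (_ : 0 < C%:R)); lra.
have SNM : S N%:R <= S M by apply: S_mono.
have [||t [s [x tC ans]]] := solve I w.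
- rewrite /= all_cat !(lcs_side_fits _ prm) // !andbT.
  by have [_ _ _ [_ eZ _ _ _]] := params_bounds prm; clear -Zw eZ; lia.
- have -> : (size (encoding (p := LCS) I) = 1 + (N + N))%N.
    by rewrite /= size_cat (eqP (sx false)) (eqP (sx true)).
  have base : (1 + (N + N))%:R + S N%:R + 2 <= Y ^+ (2 * C + 5).
    apply: (@le_trans _ _ (Y ^+ (2 * C + 1) * 3)).
      rewrite !natrD; have := Ypow 1%N (2 * C + 1)%N (leq_addl _ _); rewrite expr1.
      by rewrite {1}/Y; lra.
    have -> : (2 * C + 5 = 2 * C + 1 + 4)%N by clear; lia.
    rewrite [Y ^+ (_ + 4)]exprD ler_wpM2l ?exprn_ge0 //; first by lra.
    by apply: le_trans (Ypow 1%N 4%N _); rewrite // expr1; lra.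
  apply: le_trans wordY; rewrite exprM.
  apply: (@le_trans _ _ ((Y ^+ (2 * C + 5)) ^+ k)).
    apply: lerXn2r; rewrite ?nnegrE // ?exprn_ge0 //; first by rewrite !natrD; lra.
    by lra.
  apply: ler_weXn2l => //; by apply: le_trans (Ypow 0%N _ _); rewrite ?expr0.
have [t' t'C [s' x' es']] := bp_sat_run prm enc_w Zw x.
exists t', s'; split=> //.
- have : t'%:R <= (22 + 1500 * volume n T W)%:R + t%:R :> R.
    by rewrite -natrD ler_nat; move: t'C costV; rewrite -/T; clear; lia.
  rewrite natrD natrM; move: VM tC; rewrite !natrM => VM tC.
  have : C%:R * (S N%:R + 1) <= C%:R * (S M + 1) by rewrite ler_wpM2l //; lra.
  by move=> h1 h2; lra.
- rewrite /= es'; congr (nat_of_bool _); symmetry.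
  rewrite (pP prm) (pK prm) (pL prm) (pk prm); apply: lcs_decides ans.
  by rewrite (ph prm) -/n; clear; lia.
Qed.
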